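(* Let $K$ be an algebraically closed field of characteristic $p>0$, let $G = PGL_n$ over $K$ and suppose $p \mid n$. Let $\mathfrak{g}$ be the Lie algebra of $G$. Then the dual nilpotent cone $\mathcal{N}^* \subseteq \mathfrak{g}^*$ is a normal variety.
   Context: Let $\mathfrak{g}^*$ be the dual vector space of $\mathfrak{g}$, with the coadjoint action of $G$. The symmetric algebra $S(\mathfrak{g})$ is identified with the algebra $K[\mathfrak{g}^*]$ of polynomial functions on $\mathfrak{g}^*$, and $S^+(\mathfrak{g}) = \bigoplus_{i\ge 1} S^i(\mathfrak{g})$. The dual nilpotent cone (dual nilcone) is the closed subvariety $$\mathcal{N}^* = \{ X \in \mathfrak{g}^* \mid f(X) = 0 \text{ for all } f \in S^+(\mathfrak{g})^G \}.$$ A commutative ring $A$ is normal if for every prime ideal $\mathfrak{p}$ the localization $A_{\mathfrak{p}}$ is an integrally closed domain; a variety $V$ is normal if for every $x \in V$ the local ring $\mathcal{O}_{V,x}$ is a normal ring. *)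

(* Defs.v *)
From HB Require Import structures.
From mathcomp Require Import all_boot all_algebra.
From mathcomp Require Import ring.
From mathcomp Require Import boolp.
From mathcomp Require Import mpoly.

Set Implicit Arguments.
Unset Strict Implicit.
Unset Printing Implicit Defensive.

Import GRing.Theory.

Local Open Scope ring_scope.
Local Open Scope quotient_scope.

Section Localization.
Variables (A : comNzRingType) (P : prime_idealr A).
Local Notation I := (P : pred A).

Definition locfrac := {x : A * A | x.2 \notin I}.
HB.instance Definition _ := Choice.on locfrac.

Implicit Types x y z : locfrac.

Local Notation num x := (sval x).1.
Local Notation den x := (sval x).2.

Lemma notin_prime1 : 1 \notin I.
Proof. by rewrite idealr1. Qed.

Lemma notin_primeM s t : s \notin I -> t \notin I -> s * t \notin I.
Proof. by move=> sI tI; rewrite prime_idealrM negb_or sI. Qed.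

Definition mkfrac (a s : A) (sI : s \notin I) : locfrac :=
  exist (fun x : A * A => x.2 \notin I) (a, s) sI.

Definition loc_equiv x y : bool :=
  `[< exists2 u : A, u \notin I & u * (num x * den y - num y * den x) = 0 >].

Lemma loc_equiv_is_equiv : equiv_class_of loc_equiv.
Proof.
split=> [x|x y|y x z].
- by apply/asboolP; exists 1; rewrite ?notin_prime1 // subrr mulr0.
- by apply/asbool_equiv_eq; split=> -[u uI e]; exists u => //;
    rewrite -[RHS]oppr0 -e; ring.
- move=> /asboolP[u uI e] /asboolP[v vI f]; apply/asboolP.
  exists (u * v * den y); first by rewrite !notin_primeM ?(svalP y).
  have -> : u * v * den y * (num x * den z - num z * den x)
    = v * den z * (u * (num x * den y - num y * den x))
      + u * den x * (v * (num y * den z - num z * den y)) by ring.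
  by rewrite e f !mulr0 addr0.
Qed.

Canonical loc_equiv_equiv := EquivRelPack loc_equiv_is_equiv.
Canonical loc_equiv_encModRel := defaultEncModRel loc_equiv.

Definition localization := {eq_quot loc_equiv}.
HB.instance Definition _ : EqQuotient locfrac loc_equiv localization :=
  EqQuotient.on localization.
HB.instance Definition _ := Choice.on localization.

Definition zerof : locfrac := mkfrac 0 notin_prime1.
Definition onef : locfrac := mkfrac 1 notin_prime1.
Definition oppf x : locfrac := mkfrac (- num x) (svalP x).
Definition addf x y : locfrac :=
  mkfrac (num x * den y + num y * den x) (notin_primeM (svalP x) (svalP y)).
Definition mulf x y : locfrac :=
  mkfrac (num x * num y) (notin_primeM (svalP x) (svalP y)).

Definition loc_zero : localization := lift_cst localization zerof.
Definition loc_one : localization := lift_cst localization onef.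
Definition loc_opp := lift_op1 localization oppf.
Definition loc_add := lift_op2 localization addf.
Definition loc_mul := lift_op2 localization mulf.

Lemma loc_eqP x y :
  reflect (exists2 u : A, u \notin I & u * (num x * den y - num y * den x) = 0)
          (x == y %[mod localization]).
Proof. by rewrite piE; apply: asboolP. Qed.

Lemma loc_reprP x :
  exists2 u : A, u \notin I &
    u * (num x * den (repr (\pi_localization x))
         - num (repr (\pi_localization x)) * den x) = 0.
Proof. by apply/loc_eqP; rewrite reprK. Qed.

Canonical pi_loc_zero_morph := PiConst loc_zero.
Canonical pi_loc_one_morph := PiConst loc_one.

Lemma pi_loc_opp : {morph \pi : x / oppf x >-> loc_opp x}.
Proof.
move=> x; unlock loc_opp; apply/eqP/loc_eqP.
have [u uI e] := loc_reprP x; exists u => //=.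
by rewrite -[RHS]oppr0 -[in RHS]e; ring.
Qed.
Canonical pi_loc_opp_morph := PiMorph1 pi_loc_opp.

Lemma pi_loc_add : {morph \pi : x y / addf x y >-> loc_add x y}.
Proof.
move=> x y; unlock loc_add; apply/eqP/loc_eqP.
have [u uI e] := loc_reprP x; have [v vI f] := loc_reprP y.
move: (repr (\pi x)) (repr (\pi y)) e f => x' y' e f.
exists (u * v) => /=; first exact: notin_primeM.
transitivity (v * den y * den y' * (u * (num x * den x' - num x' * den x))
  + u * den x * den x' * (v * (num y * den y' - num y' * den y))); first by ring.
by rewrite e f !mulr0 addr0.
Qed.
Canonical pi_loc_add_morph := PiMorph2 pi_loc_add.

Lemma pi_loc_mul : {morph \pi : x y / mulf x y >-> loc_mul x y}.
Proof.
move=> x y; unlock loc_mul; apply/eqP/loc_eqP.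
have [u uI e] := loc_reprP x; have [v vI f] := loc_reprP y.
move: (repr (\pi x)) (repr (\pi y)) e f => x' y' e f.
exists (u * v) => /=; first exact: notin_primeM.
transitivity (v * num y * den y' * (u * (num x * den x' - num x' * den x))
  + u * num x' * den x * (v * (num y * den y' - num y' * den y))); first by ring.
by rewrite e f !mulr0 addr0.
Qed.
Canonical pi_loc_mul_morph := PiMorph2 pi_loc_mul.

Lemma frac_eq x y :
  num x * den y = num y * den x -> \pi_localization x = \pi_localization y.
Proof.
move=> e; apply/eqP/loc_eqP; exists 1; first exact: notin_prime1.
by rewrite e subrr mulr0.
Qed.

Lemma loc_addA : associative loc_add.
Proof.
by elim/quotW=> x; elim/quotW=> y; elim/quotW=> z; rewrite !piE; apply: frac_eq => /=; ring.
Qed.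

Lemma loc_addC : commutative loc_add.
Proof. by elim/quotW=> x; elim/quotW=> y; rewrite !piE; apply: frac_eq => /=; ring. Qed.

Lemma loc_add0 : left_id loc_zero loc_add.
Proof. by elim/quotW=> x; rewrite !piE; apply: frac_eq => /=; ring. Qed.

Lemma loc_addN : left_inverse loc_zero loc_opp loc_add.
Proof. by elim/quotW=> x; rewrite !piE; apply: frac_eq => /=; ring. Qed.

HB.instance Definition _ :=
  GRing.isZmodule.Build localization loc_addA loc_addC loc_add0 loc_addN.

Lemma loc_mulA : associative loc_mul.
Proof.
by elim/quotW=> x; elim/quotW=> y; elim/quotW=> z; rewrite !piE; apply: frac_eq => /=; ring.
Qed.

Lemma loc_mulC : commutative loc_mul.
Proof. by elim/quotW=> x; elim/quotW=> y; rewrite !piE; apply: frac_eq => /=; ring. Qed.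

Lemma loc_mul1 : left_id loc_one loc_mul.
Proof. by elim/quotW=> x; rewrite !piE; apply: frac_eq => /=; ring. Qed.

Lemma loc_mulD : left_distributive loc_mul loc_add.
Proof.
by elim/quotW=> x; elim/quotW=> y; elim/quotW=> z; rewrite !piE; apply: frac_eq => /=; ring.
Qed.

Lemma loc_one_neq0 : loc_one != loc_zero.
Proof.
rewrite !piE; apply/asboolPn => -[u uI] /=.
by rewrite !mulr1 subr0 mulr1 => u0; move: uI; rewrite u0 idealr0.
Qed.

HB.instance Definition _ := GRing.Zmodule_isComNzRing.Build localization
  loc_mulA loc_mulC loc_mul1 loc_mulD loc_one_neq0.

End Localization.

Definition integrally_closed (D : idomainType) : Prop :=
  forall z : {fraction D},
    integralOver (@FracField.tofrac D) z -> exists y : D, z = FracField.tofrac y.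

(* An [idomainType] carries a boolean unit test and an inverse function, which
   a bare commutative ring does not; hence the transport along an isomorphism,
   which adds no mathematical content. *)
Definition integrally_closed_domain (B : comNzRingType) : Prop :=
  exists (D : idomainType) (f : {rmorphism B -> D}),
    bijective f /\ integrally_closed D.

Definition normal_ring (A : comNzRingType) : Prop :=
  forall P : prime_idealr A, integrally_closed_domain (localization P).

Section DualSpace.
Variables (K : fieldType) (V : vectType K).

Definition dual := 'Hom(V, K^o).
HB.instance Definition _ := Vector.on dual.

(* The symmetric algebra S(V): the indeterminate ['X_i] stands for the [i]-th
   vector of the basis [vbasis fullv] of V. *)
Definition symalg := {mpoly K[\dim {:V}]}.
HB.instance Definition _ := GRing.ComNzRing.on symalg.

(* S(V) as polynomial functions on V^*: a vector v of V, as an element of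
   degree 1, is the function X |-> X v. *)
Definition symeval (f : symalg) (X : dual) : K :=
  f.@[fun i => X (vbasis fullv)`_i].

(* Nonemptiness makes the coordinate ring nonzero, as [comNzRingType] demands. *)
Record variety := Variety {
  points :> dual -> Prop;
  variety_closed : exists F : symalg -> Prop,
    forall X, points X <-> (forall f, F f -> symeval f X = 0);
  variety_inhabited : exists X, points X }.

Section LocalRings.
Variable Z : variety.

Definition vanishing : {pred symalg} :=
  fun f => `[< forall X, Z X -> symeval f X = 0 >].

Lemma vanishing_idealr : idealr_closed vanishing.
Proof.
split.
- by apply/asboolP => X _; rewrite /symeval meval0.
- apply/asboolPn => h; have [X ZX] := variety_inhabited Z.
  by move: (h X ZX) => /eqP; rewrite /symeval meval1 oner_eq0.
- move=> a f g /asboolP hf /asboolP hg; apply/asboolP => X ZX.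
  rewrite /symeval mevalD mevalM.
  by rewrite -!/(symeval _ _) hf // hg // mulr0 addr0.
Qed.

HB.instance Definition _ := isIdealr.Build symalg vanishing vanishing_idealr.

(* The reduced structure: all functions vanishing on the points are killed. *)
Definition coord_ring := {ideal_quot vanishing}.
HB.instance Definition _ := GRing.ComNzRing.on coord_ring.

Definition point := {X : dual | Z X}.

Definition coord_eval (f : coord_ring) (x : point) : K :=
  symeval (repr f) (sval x).

Lemma coord_evalE (f : symalg) (x : point) :
  coord_eval (\pi_coord_ring f) x = symeval f (sval x).
Proof.
rewrite /coord_eval; have : \pi_coord_ring (repr (\pi_coord_ring f)) == \pi_coord_ring f.
  by rewrite reprK.
move: (repr _) => g; rewrite -Quotient.idealrBE => /asboolP /(_ _ (svalP x)).
by rewrite /symeval mevalB => /eqP; rewrite subr_eq0 => /eqP.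
Qed.

Definition max_ideal (x : point) : {pred coord_ring} :=
  fun f => coord_eval f x == 0.

Lemma max_ideal_idealr x : idealr_closed (max_ideal x).
Proof.
split.
- have -> : 0 = \pi_coord_ring 0 by rewrite rmorph0.
  by rewrite unfold_in coord_evalE /symeval meval0.
- have -> : 1 = \pi_coord_ring 1 by rewrite rmorph1.
  by rewrite unfold_in coord_evalE /symeval meval1 oner_eq0.
- elim/quotW=> a; elim/quotW=> f; elim/quotW=> g.
  rewrite -rmorphM -rmorphD !unfold_in !coord_evalE /symeval mevalD mevalM.
  by move=> /eqP-> /eqP->; rewrite mulr0 addr0.
Qed.

HB.instance Definition _ x :=
  isIdealr.Build coord_ring (max_ideal x) (max_ideal_idealr x).

Lemma max_ideal_prime x : prime_idealr_closed (max_ideal x).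
Proof.
elim/quotW=> f; elim/quotW=> g.
by rewrite -rmorphM !unfold_in !coord_evalE /symeval mevalM mulf_eq0.
Qed.

HB.instance Definition _ x :=
  isPrimeIdealrClosed.Build coord_ring (max_ideal x) (@max_ideal_prime x).

Definition local_ring (x : point) : comNzRingType := localization (max_ideal x).

Definition normal_variety : Prop := forall x : point, normal_ring (local_ring x).

End LocalRings.
End DualSpace.

Section QuotientSpace.
Import VectorInternalTheory.
Variables (K : fieldType) (V : vectType K) (U : {vspace V}).

Definition quotv := Quotient.quot (U : {pred V}).
HB.instance Definition _ := GRing.Zmodule.on quotv.
HB.instance Definition _ := EqQuotient.on quotv.

Definition quotv_scale (a : K) := lift_op1 quotv ( *:%R a).

Lemma pi_quotv_scale a : {morph \pi_quotv : v / a *: v >-> quotv_scale a v}.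
Proof.
move=> v; unlock quotv_scale; apply/eqP; rewrite -Quotient.idealrBE -scalerBr.
by apply: rpredZ; rewrite Quotient.idealrBE reprK.
Qed.

Lemma quotv_scaleA a b v : quotv_scale a (quotv_scale b v) = quotv_scale (a * b) v.
Proof. by elim/quotW: v => v; rewrite -!pi_quotv_scale scalerA. Qed.

Lemma quotv_scale1 : left_id 1 quotv_scale.
Proof. by elim/quotW=> v; rewrite -pi_quotv_scale scale1r. Qed.

Lemma quotv_scaleDr : right_distributive quotv_scale +%R.
Proof.
move=> a; elim/quotW=> v; elim/quotW=> w.
by rewrite -[\pi v + _]raddfD -!pi_quotv_scale -raddfD scalerDr.
Qed.

Lemma quotv_scaleDl v : {morph quotv_scale^~ v : a b / a + b}.
Proof.
by elim/quotW: v => v a b; rewrite -!pi_quotv_scale -raddfD scalerDl.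
Qed.

HB.instance Definition _ := GRing.Zmodule_isLmodule.Build K quotv
  quotv_scaleA quotv_scale1 quotv_scaleDr quotv_scaleDl.

Lemma quotv_eqP (v w : V) :
  reflect (\pi_quotv v = \pi_quotv w) (v - w \in U).
Proof. by rewrite Quotient.idealrBE; apply: eqP. Qed.

Lemma pi_quotv_is_linear : linear \pi_quotv.
Proof. by move=> a v w; rewrite raddfD; congr (_ + _); apply: pi_quotv_scale. Qed.

HB.instance Definition _ := GRing.isSemilinear.Build K V quotv _ \pi_quotv
  (GRing.semilinear_linear pi_quotv_is_linear).

(* The complement of U only serves to show finite dimensionality. *)
Let compl_proj (v : V) : subvs_of U^C%VS := vsproj U^C (daddv_pi U^C U v).

Let compl_capv : (U^C :&: U = 0)%VS.
Proof. by rewrite capvC capv_compl. Qed.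

Let daddv_compl v : daddv_pi U^C U v + daddv_pi U U^C v = v.
Proof. by rewrite daddv_pi_add // addvC addv_complf memvf. Qed.

Let val_compl_proj v : vsval (compl_proj v) = daddv_pi U^C U v.
Proof. by rewrite vsprojK // memv_pi. Qed.

Let pi_compl_proj v : \pi_quotv (vsval (compl_proj v)) = \pi_quotv v.
Proof.
apply/quotv_eqP; rewrite val_compl_proj -{2}(daddv_compl v) opprD addNKr.
by rewrite rpredN memv_pi.
Qed.

Let compl_proj_eq v w : \pi_quotv v = \pi_quotv w -> compl_proj v = compl_proj w.
Proof.
move=> /quotv_eqP vwU; apply: val_inj; rewrite /= !val_compl_proj.
apply/eqP; rewrite -subr_eq0 -linearB /=; set u := v - w.
have uU : daddv_pi U U^C u = u by rewrite daddv_pi_id // capv_compl.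
by rewrite -[_ u](addrK (daddv_pi U U^C u)) daddv_compl uU subrr.
Qed.

Fact quotv_vect_iso : Vector.axiom (dim (subvs_of U^C%VS)) quotv.
Proof.
exists (fun q => v2r (compl_proj (repr q))).
  move=> a q r; rewrite -linearP; congr v2r.
  rewrite (@compl_proj_eq _ (a *: repr q + repr r)).
    by rewrite /compl_proj !linearP.
  by rewrite [RHS]pi_quotv_is_linear !reprK.
exists (fun r => \pi_quotv (vsval (r2v r))).
  by move=> q; rewrite v2rK pi_compl_proj reprK.
move=> r; rewrite (@compl_proj_eq _ (vsval (r2v r))) ?reprK //.
rewrite -[RHS]r2vK; congr v2r; apply: val_inj; rewrite /= val_compl_proj.
by rewrite daddv_pi_id // subvsP.
Qed.

HB.instance Definition _ := Lmodule_hasFinDim.Build K quotv quotv_vect_iso.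

End QuotientSpace.

Section ProjectiveLinearGroup.
Variables (K : fieldType) (n : nat).

Definition GL := {g : 'M[K]_n | g \in unitmx}.
HB.instance Definition _ := Choice.on GL.

Definition mkGL (g : 'M[K]_n) (gU : g \in unitmx) : GL :=
  exist (fun g : 'M[K]_n => g \in unitmx) g gU.

Fact GL_mul_unit (g h : GL) : sval g *m sval h \in unitmx.
Proof. by rewrite unitmx_mul (svalP g) (svalP h). Qed.

Fact GL_inv_unit (g : GL) : invmx (sval g) \in unitmx.
Proof. by rewrite unitmx_inv (svalP g). Qed.

Definition GL_one : GL := mkGL (unitmx1 K n).
Definition GL_mul (g h : GL) : GL := mkGL (GL_mul_unit g h).
Definition GL_inv (g : GL) : GL := mkGL (GL_inv_unit g).

Definition proportional (g h : GL) : bool :=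
  `[< exists2 c : K, c != 0 & sval g = c *: sval h >].

Lemma proportional_is_equiv : equiv_class_of proportional.
Proof.
split=> [g|g h|h g k].
- by apply/asboolP; exists 1; rewrite ?oner_neq0 ?scale1r.
- by apply/asbool_equiv_eq; split=> -[c c0 e]; exists c^-1;
    rewrite ?invr_eq0 // e scalerA mulVf ?scale1r.
- move=> /asboolP[c c0 e] /asboolP[d d0 f]; apply/asboolP.
  by exists (c * d); rewrite ?mulf_neq0 // e f scalerA.
Qed.

Canonical proportional_equiv := EquivRelPack proportional_is_equiv.
Canonical proportional_encModRel := defaultEncModRel proportional.

Definition PGL := {eq_quot proportional}.
HB.instance Definition _ : EqQuotient GL proportional PGL := EqQuotient.on PGL.
HB.instance Definition _ := Choice.on PGL.

Lemma PGL_eqP (g h : GL) :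
  reflect (exists2 c : K, c != 0 & sval g = c *: sval h) (g == h %[mod PGL]).
Proof. by rewrite piE; apply: asboolP. Qed.

Lemma PGL_reprP (g : GL) :
  exists2 c : K, c != 0 & sval (repr (\pi_PGL g)) = c *: sval g.
Proof. by apply/PGL_eqP; rewrite reprK. Qed.

Definition PGL_one : PGL := lift_cst PGL GL_one.
Definition PGL_inv := lift_op1 PGL GL_inv.
Definition PGL_mul := lift_op2 PGL GL_mul.

Canonical pi_PGL_one_morph := PiConst PGL_one.

Lemma pi_PGL_inv : {morph \pi : g / GL_inv g >-> PGL_inv g}.
Proof.
move=> g; unlock PGL_inv; apply/eqP; rewrite eq_sym; apply/PGL_eqP.
have [c c0 /= ->] := PGL_reprP g.
by exists c^-1; rewrite ?invr_eq0 // invmxZ // unitmxZ ?unitfE ?(svalP g).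
Qed.
Canonical pi_PGL_inv_morph := PiMorph1 pi_PGL_inv.

Lemma pi_PGL_mul : {morph \pi : g h / GL_mul g h >-> PGL_mul g h}.
Proof.
move=> g h; unlock PGL_mul; apply/eqP; rewrite eq_sym; apply/PGL_eqP.
have [c c0 /= ->] := PGL_reprP g; have [d d0 /= ->] := PGL_reprP h.
by exists (c * d); rewrite ?mulf_neq0 // -scalemxAl -scalemxAr scalerA.
Qed.
Canonical pi_PGL_mul_morph := PiMorph2 pi_PGL_mul.

Lemma PGL_mulA : associative PGL_mul.
Proof.
elim/quotW=> g; elim/quotW=> h; elim/quotW=> k; rewrite !piE.
by congr \pi; apply: val_inj; rewrite /= mulmxA.
Qed.

Lemma PGL_mul1 : left_id PGL_one PGL_mul.
Proof.
by elim/quotW=> g; rewrite !piE; congr \pi; apply: val_inj; rewrite /= mul1mx.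
Qed.

Lemma PGL_mulr1 : right_id PGL_one PGL_mul.
Proof.
by elim/quotW=> g; rewrite !piE; congr \pi; apply: val_inj; rewrite /= mulmx1.
Qed.

Lemma PGL_mulV : left_inverse PGL_one PGL_inv PGL_mul.
Proof.
elim/quotW=> g; rewrite !piE; congr \pi; apply: val_inj.
by rewrite /= mulVmx ?(svalP g).
Qed.

Lemma PGL_mulrV : right_inverse PGL_one PGL_inv PGL_mul.
Proof.
elim/quotW=> g; rewrite !piE; congr \pi; apply: val_inj.
by rewrite /= mulmxV ?(svalP g).
Qed.

HB.instance Definition _ :=
  isGroup.Build PGL PGL_mulA PGL_mul1 PGL_mulr1 PGL_mulV PGL_mulrV.

(* Lie(PGL_n) = Lie(GL_n) / Lie(G_m) = gl_n / K.1, in every characteristic.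
   When the characteristic divides n this is not isomorphic to sl_n. *)
Definition pgl := quotv <[1%:M : 'M[K]_n]>%VS.
HB.instance Definition _ := Vector.on pgl.
HB.instance Definition _ := EqQuotient.on pgl.

Definition GL_Ad (g : GL) (A : 'M[K]_n) : 'M[K]_n :=
  sval g *m A *m invmx (sval g).

Definition Ad (g : PGL) (x : pgl) : pgl := \pi_pgl (GL_Ad (repr g) (repr x)).

Lemma GL_Ad_is_linear g : linear (GL_Ad g).
Proof.
by move=> a A B; rewrite /GL_Ad mulmxDr mulmxDl -scalemxAr -scalemxAl.
Qed.

Lemma AdE (g : GL) (A : 'M[K]_n) :
  Ad (\pi_PGL g) (\pi_pgl A) = \pi_pgl (GL_Ad g A).
Proof.
rewrite /Ad; have [c c0 e] := PGL_reprP g.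
have -> B : GL_Ad (repr (\pi_PGL g)) B = GL_Ad g B.
  rewrite /GL_Ad e invmxZ ?unitmxZ ?unitfE ?(svalP g) //.
  by rewrite -!scalemxAl -scalemxAr scalerA mulfV // scale1r.
apply/quotv_eqP.
have /vlineP[k ek] : repr (\pi_pgl A) - A \in <[1%:M : 'M[K]_n]>%VS.
  by apply/quotv_eqP; rewrite reprK.
rewrite -(subrK A (repr _)) ek GL_Ad_is_linear addrK /GL_Ad mulmx1.
by rewrite mulmxV ?(svalP g) // rpredZ // memv_line.
Qed.

Lemma Ad_is_linear g : linear (Ad g).
Proof.
elim/quotW: g => g a; elim/quotW=> A; elim/quotW=> B.
by rewrite -linearP !AdE GL_Ad_is_linear linearP.
Qed.

Definition coAd (g : PGL) (X : dual pgl) : dual pgl :=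
  linfun (fun x : pgl => X (Ad g^-1%g x) : K^o).

Lemma coAdE g X x : coAd g X x = X (Ad g^-1%g x).
Proof.
have lin : linear (fun x : pgl => X (Ad g^-1%g x) : K^o).
  by move=> a y z; rewrite Ad_is_linear linearP.
pose F := GRing.isSemilinear.Build K pgl K^o _ _ (GRing.semilinear_linear lin).
pose f : {linear pgl -> K^o} := HB.pack (fun x : pgl => X (Ad g^-1%g x) : K^o) F.
exact: (lfunE f x).
Qed.

(* PGL_n acts on S(pgl_n) through the identification with functions, i.e. by
   (g . f)(X) = f (g^-1 . X); K being infinite where this is used, a polynomial
   is determined by its values. *)
Definition coAd_invariant (f : symalg pgl) : Prop :=
  forall (g : PGL) (X : dual pgl), symeval f (coAd g X) = symeval f X.

(* f lies in the sum of the homogeneous components S^i with i >= 1. *)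
Definition positive_degree (f : symalg pgl) : Prop := f@_0%MM = 0.

Definition nilcone_points (X : dual pgl) : Prop :=
  forall f, positive_degree f /\ coAd_invariant f -> symeval f X = 0.

Fact nilcone_closed : exists F : symalg pgl -> Prop,
  forall X, nilcone_points X <-> (forall f, F f -> symeval f X = 0).
Proof. by exists (fun f => positive_degree f /\ coAd_invariant f). Qed.

Fact nilcone_inhabited : exists X, nilcone_points X.
Proof.
exists 0 => f [f0 _]; rewrite /symeval -[RHS]f0 [in LHS](mpolyE f) [in RHS](mpolyE f).
rewrite !raddf_sum; apply: eq_bigr => m _ /=; rewrite mevalZ mcoeffZ mevalX mcoeffX.
congr (_ * _); have [->|/eqP m0] := eqVneq m 0%MM.
  by apply: big1 => i _; rewrite mnm0E.
have [i mi] : exists i, m i != 0%N.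
  apply/existsP; apply: contra_notT m0 => /existsPn m0; apply/mnmP => i.
  by rewrite mnm0E; apply/eqP; move: (m0 i); rewrite negbK.
by rewrite (bigD1 i) //= lfunE /= expr0n (negPf mi) mul0r.
Qed.

Definition dual_nilcone : variety pgl :=
  Variety nilcone_closed nilcone_inhabited.

End ProjectiveLinearGroup.

(* Main.v *)
Require Import Defs.
From HB Require Import structures.
From mathcomp Require Import all_boot all_order all_algebra perm.
From mathcomp Require Import ring zify boolp mpoly.

(* The trace form identifies the dual nilcone with the cone of nilpotent n x n matrices A,
   since an invariant polynomial is constant on this cone. Let S be the polynomial ring in
   the entries of A, and I the ideal generated by the lower coefficients of the
   characteristic polynomial. These are affine functions of the first row of A, whose linear
   parts are cofactors of x - A: the determinant f of this linear system only depends on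
   the other rows. By Cramer's rule, (S/I)[1/f] is the localization at f of the
   polynomial ring in the other rows, so it is normal; the same holds for the transpose g
   of f. If moreover (f, g) is a regular sequence in S/I, then S/I is the intersection of
   (S/I)[1/f] and (S/I)[1/g], hence it is a normal domain, and I is the full ideal of the
   nilpotent cone.
   Regularity comes from a monomial order whose weights are strictly concave in the
   distance to the diagonal: as the characteristic coefficients, f and g have total slope
   (row minus column) 0, d and -d in degrees k, d and d, their leading monomials live on
   the diagonal, the subdiagonal and the superdiagonal respectively. After replacing the
   characteristic coefficients by their divided differences at the diagonal entries, all
   the leading monomials are pairwise coprime. *)

Set Implicit Arguments.
Unset Strict Implicit.
Unset Printing Implicit Defensive.

Import Order.TTheory GRing.Theory Num.Theory.

(** * Integral closedness by divisibility relations *)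

Section ElementwiseNormality.
Local Open Scope ring_scope.
Local Open Scope quotient_scope.

Definition domain_ring (B : comNzRingType) :=
  forall x y : B, x * y = 0 -> x = 0 \/ y = 0.

(* [homog_eval p x y] is y^d p(x / y), where d is the degree of p. *)
Definition homog_eval (B : comNzRingType) (p : {poly B}) (x y : B) :=
  \sum_(i < size p) p`_i * x ^+ i * y ^+ ((size p).-1 - i).

(** Integral closedness without a fraction field: if x / y is integral, then y divides x. In this
    form it applies to bare commutative rings such as coordinate rings and localizations. *)
Definition int_dvd (B : comNzRingType) :=
  forall (p : {poly B}) (x y : B), p \is monic -> y <> 0 ->
    homog_eval p x y = 0 -> exists z, x = z * y.

Definition icd (B : comNzRingType) := domain_ring B /\ int_dvd B.

Lemma fraction_repr (D : idomainType) (z : {fraction D}) :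
  exists x y : D, y != 0 /\ z = FracField.tofrac x / FracField.tofrac y.
Proof.
elim/quotW: z => z; exists (frac z).1, (frac z).2.
have d0 := denom_ratioP z; split=> //.
apply: (canRL (mulfK _)); first by rewrite tofrac_eq0.
unlock FracField.tofrac; rewrite -[LHS]FracField.pi_mul; apply/eqmodP => /=.
by rewrite FracField.equivfE /= !numden_Ratio ?(oner_eq0, mulf_neq0, mulr1) // mulrC.
Qed.

Lemma homog_eval_root (B : comNzRingType) (F : fieldType) (f : {rmorphism B -> F})
    (p : {poly B}) (x y : B) : p \is monic -> f y != 0 ->
  root (map_poly f p) (f x / f y) -> f (homog_eval p x y) = 0.
Proof.
move=> pm fy0 /rootP pz; rewrite /homog_eval rmorph_sum /=.
transitivity (f y ^+ (size p).-1 * (map_poly f p).[f x / f y]); last by rewrite pz mulr0.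
rewrite horner_coef size_map_poly_id0; last first.
  by rewrite (monicP pm) rmorph1 oner_eq0.
rewrite big_distrr; apply: eq_bigr => i _ /=.
rewrite !rmorphM !rmorphXn coef_map expr_div_n /=.
have lei : (i <= (size p).-1)%N by rewrite -ltnS prednK // (leq_ltn_trans _ (ltn_ord i)).
rewrite -[in RHS](subnK lei) exprD.
have fi0 : f y ^+ i != 0 by rewrite expf_neq0.
by field.
Qed.

Lemma icd_integrally_closed (D : idomainType) : int_dvd D -> integrally_closed D.
Proof.
move=> iD z [p pm pz]; have [x [y [y0 e]]] := fraction_repr z.
have Fy0 : FracField.tofrac y != 0 by rewrite tofrac_eq0.
have [|w ew] := iD p x y pm (elimN eqP y0).
  rewrite e in pz; apply/eqP; rewrite -tofrac_eq0; apply/eqP.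
  exact: (@homog_eval_root D {fraction D} _ p x y pm Fy0 pz).
by exists w; rewrite e ew rmorphM /= mulfK.
Qed.

(** Classical choice equips B with a unit test and an inverse, so D is B itself and the isomorphism
    is the identity. *)
Lemma icd_domain (B : comNzRingType) : icd B -> integrally_closed_domain B.
Proof.
case=> dB iB.
pose U : {pred B} := fun x => `[< exists y, y * x = 1 >].
pose inv (x : B) := if pselect (exists y, y * x = 1) is left h then projT1 (cid h) else x.
have mulV : {in U, left_inverse 1 inv *%R}.
  by move=> x /asboolP h; rewrite /inv; case: pselect => // h'; case: cid.
have unitP : forall x y : B, y * x = 1 -> x \in U by move=> x y h; apply/asboolP; exists y.
have invid : {in [predC U], inv =1 id}.
  by move=> x /asboolPn h; rewrite /inv; case: pselect.
pose m1 := GRing.ComNzRing_hasMulInverse.Build B mulV unitP invid.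
pose B1 : comUnitRingType := HB.pack (GRing.ComNzRing.sort B) m1.
have ax : GRing.integral_domain_axiom B1.
  by move=> x y /dB[->|->]; rewrite eqxx ?orbT.
pose m2 := GRing.ComUnitRing_isIntegral.Build B1 ax.
pose D : idomainType := HB.pack (GRing.ComNzRing.sort B) m1 m2.
have f0 : zmod_morphism (id : B -> D) by [].
have f1 : monoid_morphism (id : B -> D) by [].
pose f : {rmorphism B -> D} := HB.pack (id : B -> D)
  (GRing.isZmodMorphism.Build B D id f0) (GRing.isMonoidMorphism.Build B D id f1).
exists D, f; split; first by exists id.
exact: (@icd_integrally_closed D iB).
Qed.

Lemma subn_predS (i n : nat) : (i < n)%N -> (n.-1 - i).+1 = (n - i)%N.
Proof. by case: n => // n lein; rewrite subSn. Qed.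

(* Clearing denominators in a homogenized monic relation. *)
Section Fractions.
Variables (Q B : comNzRingType) (iota : {rmorphism Q -> B}) (T : Q -> Prop).
Hypothesis T1 : T 1.
Hypothesis TM : forall s t, T s -> T t -> T (s * t).
Hypothesis iota_reg : forall s b, T s -> iota s * b = 0 -> b = 0.
Hypothesis iota_inj : injective iota.
Hypothesis denom : forall b, exists2 s, T s & exists a, iota s * b = iota a.

Lemma fractions_domain : domain_ring Q -> domain_ring B.
Proof.
move=> dQ x y xy0.
have [s Ts [a ea]] := denom x; have [t Tt [b eb]] := denom y.
have : a * b = 0.
  apply: iota_inj; rewrite rmorphM -ea -eb rmorph0.
  by transitivity (iota s * iota t * (x * y)); [ring | rewrite xy0 mulr0].
case/dQ => e0; [left | right].
  by apply: (iota_reg Ts); rewrite ea e0 rmorph0.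
by apply: (iota_reg Tt); rewrite eb e0 rmorph0.
Qed.

Lemma common_denom (r : seq B) :
  exists2 s, T s & forall b, b \in r -> exists a, iota s * b = iota a.
Proof.
elim: r => [|b r [s Ts h]]; first by exists 1.
have [t Tt [a ea]] := denom b; exists (t * s); first exact: TM.
move=> c; rewrite inE => /orP[/eqP->|/h[d ed]].
  by exists (s * a); rewrite !rmorphM -ea; ring.
by exists (t * d); rewrite !rmorphM -ed mulrA.
Qed.

(** The elements of T are regular in B but possibly not invertible there, hence the factor s in the
    conclusion. The charts below use it with powers of one element. *)
Lemma fractions_int_dvd (p : {poly B}) (x y : B) : int_dvd Q ->
  p \is monic -> y <> 0 -> homog_eval p x y = 0 ->
  exists2 s, T s & exists z, iota s * x = z * y.
Proof.
move=> iQ pm y0 pxy.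
have [s Ts h] := common_denom [:: x, y & p].
have [x' ex] : exists a, iota s * x = iota a by apply: h; rewrite inE eqxx.
have [y' ey] : exists a, iota s * y = iota a by apply: h; rewrite !inE eqxx orbT.
have hp (i : nat) : exists a, iota s * p`_i = iota a.
  have [lti|gei] := ltnP i (size p).
    by apply: h; rewrite !inE mem_nth ?orbT.
  by exists 0; rewrite nth_default // mulr0 rmorph0.
pose c i := projT1 (cid (hp i)).
have cE i : iota s * p`_i = iota (c i) by rewrite /c; case: cid.
set n := (size p).-1.
have sp : size p = n.+1 by rewrite prednK // lt0n size_poly_eq0 monic_neq0.
(* If x / y is a root of p, then s x / y is a root of the monic polynomial with coefficients s^(n -
   i) p_i; for i < n these come from Q, because s p_i does. *)
pose r := \poly_(i < n) (s ^+ (n.-1 - i) * c i); pose q := 'X^n + r.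
have szr : (size r < size ('X^n : {poly Q})%R)%N.
  by rewrite size_polyXn ltnS size_poly.
have qm : q \is monic by rewrite monicE /q lead_coefDl // lead_coefXn.
have sq : size q = n.+1 by rewrite /q size_polyDl // size_polyXn.
have [||z ez] := iQ q (s * x') y' qm.
- move=> y'0; apply: y0; apply: (iota_reg Ts).
  by rewrite ey y'0 rmorph0.
- apply: iota_inj; rewrite rmorph0.
  transitivity (iota s ^+ n * iota s ^+ n * homog_eval p x y); last by rewrite pxy mulr0.
  rewrite /homog_eval sp sq rmorph_sum mulr_sumr; apply: eq_bigr => i _ /=.
  rewrite !rmorphM !rmorphXn rmorphM /= -ex -ey.
  have li : (i <= n)%N by rewrite -ltnS.
  have -> : iota q`_i = iota s ^+ (n - i) * p`_i.
    rewrite /q coefD coefXn /r coef_poly.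
    case: (ltngtP i n) li => // [lin _|-> _]; last first.
      by rewrite addr0 rmorph1 subnn mul1r -[p`_n]/(lead_coef p) (monicP pm).
    rewrite add0r rmorphM rmorphXn /= -cE mulrA -exprSr; congr (_ ^+ _ * _).
    exact: subn_predS.
  rewrite !exprMn; set u := iota s.
  have -> : u ^+ n = u ^+ (n - i) * u ^+ i by rewrite -exprD subnK.
  move: (u ^+ (n - i)) (u ^+ i) => v w; ring.
exists (s * s); first exact: TM.
exists (iota z * iota s); rewrite rmorphM -mulrA ex -rmorphM ez rmorphM -ey; ring.
Qed.

End Fractions.

(** * Passage to localizations *)

Section LocalizationNormal.
Variables (A : comNzRingType) (P : prime_idealr A).
Local Notation L := (localization P).

Definition loc_inj (a : A) : L := \pi_L (mkfrac a (notin_prime1 P)).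

Lemma pi_locD (x y : locfrac P) : \pi_L x + \pi_L y = \pi_L (Defs.addf x y).
Proof. by rewrite [RHS]pi_loc_add. Qed.

Lemma pi_locM (x y : locfrac P) : \pi_L x * \pi_L y = \pi_L (Defs.mulf x y).
Proof. by rewrite [RHS]pi_loc_mul. Qed.

Lemma pi_locN (x : locfrac P) : - \pi_L x = \pi_L (Defs.oppf x).
Proof. by rewrite [RHS]pi_loc_opp. Qed.

Lemma loc_inj_zmod : zmod_morphism loc_inj.
Proof.
by move=> a b; rewrite /loc_inj pi_locN pi_locD; apply: frac_eq => /=; ring.
Qed.

Lemma loc_inj_monoid : monoid_morphism loc_inj.
Proof.
split; first by rewrite /loc_inj [RHS]/GRing.one /= !piE.
by move=> a b; rewrite /loc_inj pi_locM; apply: frac_eq => /=; ring.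
Qed.

HB.instance Definition _ := GRing.isZmodMorphism.Build A L loc_inj loc_inj_zmod.
HB.instance Definition _ := GRing.isMonoidMorphism.Build A L loc_inj loc_inj_monoid.

Lemma loc_injV s : s \notin P -> exists t : L, t * loc_inj s = 1.
Proof.
move=> sP; exists (\pi_L (mkfrac 1 sP)); rewrite -(rmorph1 loc_inj) pi_locM.
by apply: frac_eq => /=; ring.
Qed.

Lemma loc_denom (b : L) : exists2 s, s \notin P & exists a, loc_inj s * b = loc_inj a.
Proof.
elim/quotW: b => -[[a s] /= sP]; exists s => //; exists a.
by rewrite pi_locM; apply: frac_eq => /=; ring.
Qed.

Lemma icd_localization : icd A -> icd L.
Proof.
case=> dA iA.
have reg s b : s \notin P -> loc_inj s * b = 0 -> b = 0.
  by move=> /loc_injV[t ts] e; rewrite -[b]mul1r -ts -mulrA e mulr0.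
have inj : injective loc_inj.
  move=> a b /eqP/loc_eqP[u uP] /=; rewrite !mulr1 => /dA[u0|/eqP].
    by move: uP; rewrite u0 idealr0.
  by rewrite subr_eq0 => /eqP.
have PM s t : s \notin P -> t \notin P -> s * t \notin P by apply: notin_primeM.
split; first exact: (fractions_domain reg inj loc_denom).
move=> p x y pm y0 pxy.
have [s sP [z ez]] := fractions_int_dvd (notin_prime1 P) PM reg inj loc_denom iA pm y0 pxy.
have [t ts] := loc_injV sP.
by exists (t * z); rewrite -mulrA -ez mulrA ts mul1r.
Qed.

End LocalizationNormal.

Lemma icd_normal_ring (A : comNzRingType) : icd A -> normal_ring A.
Proof. by move=> iA P; apply/icd_domain/icd_localization. Qed.

(** Two localizations are involved: at the point x, then at a prime of the local ring. *)
Lemma icd_normal_variety (K : fieldType) (V : vectType K) (Z : variety V) :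
  icd (coord_ring Z) -> normal_variety Z.
Proof. by move=> iZ x; apply/icd_normal_ring/icd_localization. Qed.

End ElementwiseNormality.

(** * Polynomial rings are integrally closed *)

Section CompletelyIntegrallyClosed.
Local Open Scope ring_scope.

(* Complete integral closedness, which unlike integral closedness passes to polynomial
   rings by an easy argument. *)
Definition cic (D : idomainType) := forall x y d : D, y != 0 -> d != 0 ->
  (forall k, exists w, d * x ^+ k = w * y ^+ k) -> exists z, x = z * y.

(** If x / y is a root of a monic polynomial of degree n, then y^n clears the denominators of all
    powers of x / y: up to the n-th power this is clear, and beyond it the relation leads back to
    lower powers. *)
Lemma cic_icd (D : idomainType) : cic D -> icd D.
Proof.
move=> cD; split=> [x y /eqP|p x y pm /eqP y0 pxy].
  by rewrite mulf_eq0 => /orP[]/eqP->; [left|right].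
set n := (size p).-1.
have sp : size p = n.+1 by rewrite prednK // lt0n size_poly_eq0 monic_neq0.
apply: (cD x y (y ^+ n)) => //; first by rewrite expf_neq0.
elim/ltn_ind => k IH; have [lekn|ltnk] := leqP k n.
  by exists (y ^+ (n - k) * x ^+ k); rewrite mulrAC -exprD subnK.
have xn : x ^+ n = - \sum_(i < n) p`_i * x ^+ i * y ^+ (n - i).
  move: pxy; rewrite /homog_eval sp big_ord_recr /= subnn mulr1.
  rewrite -[p`_n]/(lead_coef p) (monicP pm) mul1r.
  by move/eqP; rewrite addrC addr_eq0 => /eqP.
have /choice[w ew] : forall i, exists w, (i < n)%N ->
    y ^+ n * x ^+ (k - n + i) = w * y ^+ (k - n + i).
  move=> i; have [lin|] := ltnP i n; last by exists 0.
  by have [|w] := IH (k - n + i)%N; [rewrite -ltn_subRL subKn // ltnW | exists w].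
exists (- \sum_(i < n) p`_i * w i).
rewrite -{1}(subnK (ltnW ltnk)) exprD xn !mulrN mulNr mulr_suml !mulr_sumr.
congr (- _); apply: eq_bigr => i _.
transitivity (p`_i * (y ^+ n * x ^+ (k - n + i)) * y ^+ (n - i)).
  rewrite exprD; ring.
rewrite ew // -!mulrA -exprD; congr (_ * (_ * y ^+ _)).
by rewrite -addnA subnKC ?(ltnW (ltn_ord i)) // subnK // ltnW.
Qed.

Section PolyCic.
Variable D : idomainType.
Hypothesis cD : cic D.
Local Notation F := {fraction D}.
Local Notation tf := (@FracField.tofrac D).
Local Notation tfp := (map_poly tf).

Let im (p : {poly F}) := exists w : {poly D}, p = tfp w.

Let imD p q : im p -> im q -> im (p + q).
Proof. by case=> a -> [b ->]; exists (a + b); rewrite rmorphD. Qed.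

Let imM p q : im p -> im q -> im (p * q).
Proof. by case=> a -> [b ->]; exists (a * b); rewrite rmorphM. Qed.

Let imX p k : im p -> im (p ^+ k).
Proof. by case=> a ->; exists (a ^+ k); rewrite rmorphXn. Qed.

(* Compare leading coefficients in d z^k, then subtract the leading term of z. *)
Lemma almost_integral_poly (d : {poly D}) (z : {poly F}) : d != 0 ->
  (forall k, im (tfp d * z ^+ k)) -> im z.
Proof.
move=> d0; have [n] := ubnP (size z); elim: n z => // n IH z szn hz.
have [->|z0] := eqVneq z 0; first by exists 0; rewrite rmorph0.
have [a [b [b0 lz]]] := fraction_repr (lead_coef z).
have tfb0 : tf b != 0 by rewrite tofrac_eq0.
have ld0 : lead_coef d != 0 by rewrite lead_coef_eq0.
have [|c ac] := @cD a b (lead_coef d) b0 ld0.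
  move=> k; have [w ew] := hz k; exists (lead_coef w).
  apply/eqP; rewrite -tofrac_eq !rmorphM !rmorphXn /=; apply/eqP.
  have := congr1 lead_coef ew.
  have tfi : injective tf by move=> u v /eqP; rewrite tofrac_eq => /eqP.
  rewrite lead_coefM lead_coef_exp !lead_coef_map_inj ?rmorph0 //.
  by rewrite lz expr_div_n => <-; rewrite -mulrA divfK ?expf_neq0.
have lzc : lead_coef z = tf c by rewrite lz ac rmorphM /= mulfK.
pose t := tfp (c%:P * 'X^((size z).-1)).
have imt : im t by eexists.
have tE : t = lead_coef z *: 'X^((size z).-1).
  by rewrite /t rmorphM /= map_polyC map_polyXn mul_polyC lzc.
rewrite -(subrK t z); apply: imD => //; apply: IH.
  have sz1 : (0 < size z)%N by rewrite lt0n size_poly_eq0.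
  suff: (size (z - t)%R < size z)%N by move=> h; rewrite (leq_trans h) // -ltnS.
  rewrite -[X in (_ < X)%N](prednK sz1) ltnS; apply/leq_sizeP => j lej.
  rewrite coefB tE coefZ coefXn; case: ltngtP lej => // [ltj _|<- _]; last first.
    by rewrite mulr1 subrr.
  by rewrite mulr0 subr0 nth_default // -(prednK sz1).
move=> k; rewrite exprDn mulr_sumr.
elim/big_rec: _ => [|i p _ imp]; first by exists 0; rewrite rmorph0.
apply: imD => //; rewrite -mulrnAr mulrA; apply: imM => //.
elim: 'C(k, i) => [|m [u eu]]; first by exists 0; rewrite rmorph0.
rewrite mulrS; apply: imD; last by exists u.
by apply: imX; case: imt => v ->; exists (- v); rewrite rmorphN.
Qed.

(** After division by the gcd, y' is coprime to x', so every power of y' divides d; comparing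
    degrees, y' is constant. *)
Lemma almost_dvdp (R : fieldType) (d x y : {poly R}) : d != 0 -> y != 0 ->
  (forall k, y ^+ k %| d * x ^+ k) -> y %| x.
Proof.
move=> d0 y0 h; set g := gcdp x y.
have g0 : g != 0 by rewrite gcdp_eq0 negb_and y0 orbT.
have ex : x = x %/ g * g by rewrite divpK ?dvdp_gcdl.
have ey : y = y %/ g * g by rewrite divpK ?dvdp_gcdr.
have cop : coprimep (y %/ g) (x %/ g).
  by rewrite coprimep_sym coprimep_div_gcd // y0 orbT.
move: (x %/ g) (y %/ g) ex ey cop => x' y' ex ey cop.
have y'0 : y' != 0 by apply: contraNneq y0 => e; rewrite ey e mul0r.
have hd k : y' ^+ k %| d.
  have := h k; rewrite ex ey !exprMn mulrA dvdp_mul2r ?expf_neq0 //.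
  by rewrite Gauss_dvdpl // coprimep_expl // coprimep_expr.
suff: size y' == 1.
  move=> /eqP; rewrite ex ey dvdp_mul2r // => s1.
  by rewrite (eqp_dvdl _ (_ : y' %= 1)) ?dvd1p // -size_poly_eq1 s1.
have sy' : (0 < size y')%N by rewrite lt0n size_poly_eq0.
rewrite eqn_leq sy' andbT leqNgt; apply/negP => lt1.
have := dvdp_leq d0 (hd (size d)).
rewrite -[X in (X <= _)%N]prednK ?lt0n ?size_poly_eq0 ?expf_neq0 // size_exp ltnNge leq_pmull //.
by rewrite -ltnS prednK.
Qed.

(** The quotient exists first over the fraction field, by [almost_dvdp]; being almost integral, it
    has its coefficients in D. *)
Lemma cic_poly : cic {poly D}.
Proof.
move=> x y d y0 d0 h.
have tfi : injective tf by move=> u v /eqP; rewrite tofrac_eq => /eqP.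
have tfp_inj : injective tfp by apply: map_inj_poly; rewrite ?rmorph0.
have tfp0 p : p != 0 -> tfp p != 0.
  by apply: contra_neq => e; apply: tfp_inj; rewrite e rmorph0.
have /dvdpP[z ez] : tfp y %| tfp x.
  apply: (@almost_dvdp _ (tfp d)); rewrite ?tfp0 // => k.
  have [w ew] := h k; apply/dvdpP; exists (tfp w).
  by rewrite -!rmorphXn -!rmorphM ew.
have [|z' ez'] := @almost_integral_poly d z d0.
  move=> k; have [w ew] := h k; exists w.
  apply: (mulIf (expf_neq0 k (tfp0 _ y0))).
  by rewrite -mulrA -exprMn -ez -!rmorphXn -!rmorphM ew.
by exists z'; apply: tfp_inj; rewrite [LHS]ez ez' -rmorphM.
Qed.

End PolyCic.

Lemma mpoly_rmorph_ext (n : nat) (R : nzRingType) (T : nzRingType)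
    (f g : {rmorphism {mpoly R[n]} -> T}) :
  (forall c, f c%:MP = g c%:MP) -> (forall i, f 'X_i = g 'X_i) -> f =1 g.
Proof.
move=> hc hX p; elim/mpolyind: p => [|c m p _ _ IH]; first by rewrite !rmorph0.
rewrite !rmorphD IH; congr (_ + _).
rewrite -mul_mpolyC !rmorphM hc mpolyXE_id !rmorph_prod; congr (_ * _).
by apply: eq_bigr => i _; rewrite !rmorphXn /= hX.
Qed.

Lemma cic_iso (D E : idomainType) (f : {rmorphism D -> E}) (g : {rmorphism E -> D}) :
  cancel f g -> cancel g f -> cic E -> cic D.
Proof.
move=> fK gK cE x y d y0 d0 h.
have f0 u : u != 0 -> f u != 0.
  by apply: contra_neq => e; rewrite -(fK u) e rmorph0.
have [|z ez] := cE (f x) (f y) (f d) (f0 _ y0) (f0 _ d0).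
  by move=> k; have [w ew] := h k; exists (f w); rewrite -!rmorphXn -!rmorphM ew.
by exists (g z); rewrite -(fK x) ez rmorphM fK.
Qed.

(** * Splitting off the last variable of a polynomial ring *)

Section Muni.
Variables (K : fieldType) (n : nat).
Let widen (i : 'I_n) := widen_ord (leqnSn n) i.

Lemma muni_ord_max : muni 'X_ord_max = 'X :> {poly {mpoly K[n]}}.
Proof.
rewrite muniE msuppX big_seq1 mcoeffX eqxx scale1r mnm1E eqxx expr1.
rewrite (_ : [multinom _ | _ < _] = 0%MM) ?mpolyX0 ?scale1r //.
apply/mnmP => i; rewrite mnmE mnm1E mnm0E -val_eqE /=.
by rewrite gtn_eqF.
Qed.

Lemma muni_widen (i : 'I_n) :
  muni 'X_(widen_ord (leqnSn n) i) = ('X_i)%:P :> {poly {mpoly K[n]}}.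
Proof.
rewrite muniE msuppX big_seq1 mcoeffX eqxx scale1r mnm1E -val_eqE /= ltn_eqF //.
rewrite expr0 alg_polyC (_ : [multinom _ | _ < _] = U_(i)%MM) //.
by apply/mnmP => j; rewrite mnmE !mnm1E -!val_eqE.
Qed.

Definition muni_inv : {rmorphism {poly {mpoly K[n]}} -> {mpoly K[n.+1]}} :=
  horner_eval ('X_ord_max) \o map_poly (@mwiden n K).

Let gX : muni_inv 'X = 'X_ord_max.
Proof. by rewrite /muni_inv /= map_polyX /horner_eval hornerX. Qed.

Let gC c : muni_inv c%:P = mwiden c.
Proof. by rewrite /muni_inv /= map_polyC /horner_eval hornerC. Qed.

Let wX (i : 'I_n) : mwiden ('X_i : {mpoly K[n]}) = 'X_(widen i).
Proof. by rewrite mwidenX mnmwiden1. Qed.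

Let mwC c : muni (mwiden c) = c%:P :> {poly {mpoly K[n]}}.
Proof.
apply: (mpoly_rmorph_ext (f := @muni n K \o @mwiden n K) (g := polyC)) => [k|i] /=.
  by rewrite mwidenC muniC.
by rewrite wX muni_widen.
Qed.

Lemma muniK : cancel (@muni n K) muni_inv.
Proof.
move=> p; apply: (mpoly_rmorph_ext (f := muni_inv \o @muni n K) (g := idfun)) => [k|i].
  by rewrite -[LHS]/(muni_inv (muni _)) muniC gC mwidenC.
case: (unliftP ord_max i) => [j ->|->]; last first.
  by rewrite -[LHS]/(muni_inv (muni _)) muni_ord_max gX.
have -> : lift ord_max j = widen j by apply: val_inj; rewrite /= /bump leqNgt ltn_ord.
by rewrite -[LHS]/(muni_inv (muni _)) muni_widen gC wX.
Qed.

Lemma muni_invK : cancel muni_inv (@muni n K).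
Proof.
elim/poly_ind => [|p c IHp]; first by rewrite !rmorph0.
by rewrite (rmorphD muni_inv) (rmorphM muni_inv) gX gC muniD muniM muni_ord_max IHp mwC.
Qed.

End Muni.

Lemma cic_mpoly (K : fieldType) (n : nat) : cic {mpoly K[n]}.
Proof.
elim: n => [|n IH]; last exact: (cic_iso (@muniK K n) (@muni_invK K n) (cic_poly IH)).
(* Without variables all polynomials are constants, so the quotient is taken in K. *)
move=> x y d y0 _ _; exists ((x@_0 / y@_0)%:MP).
rewrite -{1}(mpolyKC x) -{2}(mpolyKC y) -mpolyCM divfK //.
by rewrite -(mpolyC_eq0 0) mpolyKC.
Qed.

Lemma icd_mpoly (K : fieldType) (n : nat) : icd {mpoly K[n]}.
Proof. exact/cic_icd/cic_mpoly. Qed.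

End CompletelyIntegrallyClosed.

(** * Regular sequences from coprime leading monomials *)

Section WeightedLeadingMonomials.
Local Open Scope ring_scope.
Variables (K : fieldType) (N : nat) (w : 'I_N -> nat).
Hypothesis w_gt0 : forall i, (0 < w i)%N.
Local Notation S := {mpoly K[N]}.
Implicit Types (p q g h a : S) (m u : 'X_{1..N}).

Definition wscale m : 'X_{1..N} := [multinom (w i * m i)%N | i < N].
Definition wdeg m : nat := (\sum_i w i * m i)%N.
Definition wsubst : S -> S := comp_mpoly [tuple 'X_i ^+ (w i) | i < N].
HB.instance Definition _ := GRing.RMorphism.on wsubst.

Lemma wscale_inj : injective wscale.
Proof.
move=> m u /mnmP e; apply/mnmP => i; move: (e i); rewrite !mnmE => /eqP.
by rewrite eqn_pmul2l // => /eqP.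
Qed.

Lemma wscaleD m u : wscale (m + u)%MM = (wscale m + wscale u)%MM.
Proof. by apply/mnmP => i; rewrite !mnmE mulnDr. Qed.

Lemma mdeg_wscale m : mdeg (wscale m) = wdeg m.
Proof. by rewrite mdegE; apply: eq_bigr => i _; rewrite mnmE. Qed.

Lemma wsubstE p : wsubst p = \sum_(m <- msupp p) p@_m *: 'X_[wscale m].
Proof.
rewrite /wsubst comp_mpolyE; apply: eq_bigr => m _; congr (_ *: _).
rewrite mpolyXE_id; apply: eq_bigr => i _.
by rewrite tnth_mktuple mnmE exprM.
Qed.

Lemma mcoeff_wsubst p u :
  (wsubst p)@_u = \sum_(m <- msupp p | wscale m == u) p@_m.
Proof.
rewrite wsubstE raddf_sum /= [RHS]big_mkcond /=; apply: eq_bigr => m _.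
by rewrite mcoeffZ mcoeffX; case: eqP; rewrite ?mulr1 ?mulr0.
Qed.

Lemma mcoeff_wsubst_wscale p m : (wsubst p)@_(wscale m) = p@_m.
Proof.
rewrite mcoeff_wsubst (eq_bigl (pred1 m)); last first.
  by move=> u /=; rewrite (inj_eq wscale_inj).
have [mp|mp] := boolP (m \in msupp p); last first.
  rewrite (memN_msupp_eq0 mp) big_seq_cond big1 // => u /andP[up /eqP e].
  by move: mp; rewrite -e up.
by rewrite -big_filter filter_pred1_uniq ?msupp_uniq // big_seq1.
Qed.

Lemma wsubst_eq0 p : (wsubst p == 0) = (p == 0).
Proof.
apply/eqP/eqP => [e|->]; last by rewrite rmorph0.
by apply/mpolyP => m; rewrite -mcoeff_wsubst_wscale e !mcoeff0.
Qed.

(* The leading monomial for the weighted degree, ties being broken by the order of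
   multinomials: it is computed after the substitution X_i -> X_i^(w i). *)
Definition wlead p : 'X_{1..N} := [multinom (mlead (wsubst p) i %/ w i)%N | i < N].

Lemma wleadE p : p != 0 -> mlead (wsubst p) = wscale (wlead p) /\ wlead p \in msupp p.
Proof.
move=> p0; have := mlead_supp (_ : wsubst p != 0); rewrite wsubst_eq0 => /(_ p0).
rewrite mcoeff_msupp mcoeff_wsubst => nz.
have [m mp e] : exists2 m, m \in msupp p & wscale m = mlead (wsubst p).
  apply: contrapT => h; move: nz; rewrite big_seq_cond big1 ?eqxx // => u /andP[up /eqP ue].
  by case: h; exists u.
rewrite /wlead -e; suff -> : [multinom (wscale m i %/ w i)%N | i < N] = m by [].
by apply/mnmP => i; rewrite !mnmE mulKn.
Qed.

Lemma wleadM p q : p != 0 -> q != 0 -> wlead (p * q) = (wlead p + wlead q)%MM.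
Proof.
move=> p0 q0; apply: wscale_inj; rewrite wscaleD.
have [ep _] := wleadE p0; have [eq _] := wleadE q0.
have [e _] := wleadE (mulf_neq0 p0 q0).
by rewrite -ep -eq -e rmorphM mleadM // wsubst_eq0.
Qed.

Lemma wlead_top p m : p@_m != 0 ->
  (forall u, u \in msupp p -> u != m -> (wdeg u < wdeg m)%N) -> wlead p = m.
Proof.
move=> pm h; have p0 : p != 0 by apply: contra_neq pm => ->; rewrite mcoeff0.
have [e up] := wleadE p0; apply/eqP; apply: contraT => /(h _ up) lt.
have : wscale m \in msupp (wsubst p) by rewrite mcoeff_msupp mcoeff_wsubst_wscale.
by move/msupp_le_mlead/lemc_mdeg; rewrite e !mdeg_wscale leqNgt lt.
Qed.

Lemma mpolyX_neq0 m : 'X_[m] != 0 :> S.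
Proof. by rewrite -msupp_eq0 msuppX. Qed.

Lemma wleadX m : wlead 'X_[m] = m.
Proof.
apply: wlead_top; first by rewrite mcoeffX eqxx oner_eq0.
by move=> u; rewrite msuppX inE => /eqP->; rewrite eqxx.
Qed.

Lemma wleadD_neq p q : p != 0 -> q != 0 -> wlead p != wlead q ->
  [/\ p + q != 0 & wlead (p + q) = wlead p \/ wlead (p + q) = wlead q].
Proof.
move=> p0 q0 ne; have [ep pp] := wleadE p0; have [eq qq] := wleadE q0.
have ne' : mlead (wsubst p) != mlead (wsubst q) by rewrite ep eq (inj_eq wscale_inj).
have pq0 : p + q != 0.
  apply: contra_neq ne => /eqP; rewrite addr_eq0 => /eqP->.
  by rewrite /wlead rmorphN mleadN.
split=> //; have [epq _] := wleadE pq0; move: epq; rewrite rmorphD mleadD // ep eq.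
by case: leP => _ /wscale_inj ->; [right|left].
Qed.

Lemma wlead_cancel a h : a != 0 -> h != 0 -> wlead a = wlead h ->
  exists c : K, a - c *: h = 0 \/
    (a - c *: h != 0 /\ (mlead (wsubst (a - c *: h)) < mlead (wsubst a))%O).
Proof.
move=> a0 h0 e; have [ea am] := wleadE a0; have [eh hm] := wleadE h0.
set m := wlead a in e ea am; exists (a@_m / h@_m).
set r := a - _; have [->|r0] := eqVneq r 0; [by left | right; split=> //].
have rm : r@_m = 0.
  by rewrite /r mcoeffB mcoeffZ divfK ?subrr // e -mcoeff_msupp.
have [er rr] := wleadE r0.
rewrite lt_neqAle; apply/andP; split.
  rewrite er ea (inj_eq wscale_inj); apply: contraL rr => /eqP->.
  by rewrite mcoeff_msupp rm eqxx.
rewrite /r rmorphB /= (le_trans (mleadB_le _ _)) // leUx lexx /=.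
by rewrite /wsubst comp_mpolyZ (le_trans (mleadZ_le _ _)) // -/(wsubst h) eh -e ea.
Qed.

Definition is_ideal (I : S -> Prop) :=
  [/\ I 0, forall a b, I a -> I b -> I (a + b) & forall a b, I b -> I (a * b)].

(** P is the set of monomials of the initial ideal of I. *)
Definition lead_set (I : S -> Prop) (P : 'X_{1..N} -> Prop) :=
  [/\ is_ideal I, forall h, I h -> h != 0 -> P (wlead h)
    & forall m, P m -> exists h, [/\ I h, h != 0 & wlead h = m]].

(** Division by I, stopped at the first leading monomial outside P. Each step lowers the leading
    monomial, in a well-founded order. *)
Lemma lead_reduce I P a : lead_set I P ->
  I a \/ exists r, [/\ I (a - r), r != 0 & ~ P (wlead r)].
Proof.
move=> [[I0 ID IM] _ IP]; have [t] : exists t, t = mlead (wsubst a) by eexists.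
elim/(well_founded_ind (@ltom_wf N)): t a => t IH a et.
have [->|a0] := eqVneq a 0; first by left.
have [/IP[h [Ih h0 eh]]|] := pselect (P (wlead a)); last first.
  by right; exists a; rewrite subrr.
have [c ac] := wlead_cancel a0 h0 (esym eh).
have Ich : I (c *: h) by rewrite -mul_mpolyC; apply: IM.
have [/eqP|[r0 lt]] := ac; first by rewrite subr_eq0 => /eqP->; left.
rewrite -et in lt.
have [Iac|[r [Ir r'0 nP]]] := IH _ lt _ erefl.
  by left; rewrite -(subrK (c *: h) a); apply: ID.
right; exists r; split=> //; have -> : a - r = (a - c *: h - r) + c *: h by ring.
exact: ID.
Qed.

(** Reduce a to r with leading monomial outside P: then r g lies in I, so the hypothesis on P brings
    the leading monomial of r back into P. *)
Lemma lead_regular I P g a : lead_set I P -> g != 0 ->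
  (forall m, P (m + wlead g)%MM -> P m) -> I (a * g) -> I a.
Proof.
move=> LS g0 Pg Iag; have [//|[r [Ir r0 nP]]] := lead_reduce a LS.
have [[I0 ID IM] PI _] := LS; case: nP; apply: Pg; rewrite -wleadM //.
apply: PI; rewrite ?mulf_neq0 //.
have -> : r * g = a * g + (- g) * (a - r) by ring.
by apply: ID => //; apply: IM.
Qed.

Definition ideal_add (I : S -> Prop) g h := exists h' a, I h' /\ h = h' + a * g.

Lemma ideal_add_is_ideal I g : is_ideal I -> is_ideal (ideal_add I g).
Proof.
move=> [I0 ID IM]; split; first by exists 0, 0; rewrite mul0r addr0.
- move=> _ _ [h [a [Ih ->]]] [k [b [Ik ->]]]; exists (h + k), (a + b).
  by split; [apply: ID | ring].
- move=> c _ [h [a [Ih ->]]]; exists (c * h), (c * a).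
  by split; [apply: IM | ring].
Qed.

(** Once a is reduced modulo I to r, the leading monomials of the part in I and of r g are distinct:
    the first is in P, the second is not. No cancellation can occur. *)
Lemma lead_set_add I P g : lead_set I P -> g != 0 ->
  (forall m, P (m + wlead g)%MM -> P m) ->
  lead_set (ideal_add I g) (fun m => P m \/ (wlead g <= m)%MM).
Proof.
move=> LS g0 Pg; have [[I0 ID IM] PI IP] := LS; split.
- by apply: ideal_add_is_ideal.
- move=> _ [h' [a [Ih' ->]]] nz.
  have [Ia|[r [Ir r0 nP]]] := lead_reduce a LS.
    by left; apply: PI => //; apply: ID => //; rewrite mulrC; apply: IM.
  have [k [Ik e]] : exists k, I k /\ h' + a * g = k + r * g.
    exists (h' + g * (a - r)); split; last by ring.
    by apply: ID => //; apply: IM.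
  have rg0 : r * g != 0 by rewrite mulf_neq0.
  have lrg : wlead (r * g) = (wlead r + wlead g)%MM by rewrite wleadM.
  have gle : (wlead g <= wlead r + wlead g)%MM by rewrite lem_addl.
  rewrite e; have [k0|k0] := eqVneq k 0.
    by right; rewrite k0 add0r lrg.
  have ne : wlead k != wlead (r * g).
    by apply/eqP => ek; apply: nP; apply: Pg; rewrite -lrg -ek; apply: PI.
  by have [_ [->|->]] := wleadD_neq k0 rg0 ne; [left; apply: PI | right; rewrite lrg].
- move=> m [/IP[h [Ih h0 hm]]|le].
    by exists h; split=> //; exists h, 0; rewrite mul0r addr0.
  exists ('X_[m - wlead g] * g); split.
  + by exists 0, 'X_[m - wlead g]; rewrite add0r.
  + by rewrite mulf_neq0 // mpolyX_neq0.
  + by rewrite wleadM ?mpolyX_neq0 // wleadX submK.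
Qed.

Fixpoint ideal_gen (gs : seq S) : S -> Prop :=
  if gs is g :: gs' then ideal_add (ideal_gen gs') g else fun h => h = 0.

Lemma ideal_gen_is_ideal gs : is_ideal (ideal_gen gs).
Proof.
elim: gs => [|g gs IH]; last exact: ideal_add_is_ideal.
by split=> [//|a b -> ->|a b ->]; rewrite ?addr0 ?mulr0.
Qed.

Lemma ideal_gen_mem gs g : g \in gs -> ideal_gen gs g.
Proof.
elim: gs => // h gs IH; have [I0 _ _] := ideal_gen_is_ideal gs.
rewrite inE => /orP[/eqP->|/IH Ig]; first by exists 0, 1; rewrite mul1r add0r.
by exists g, 0; rewrite mul0r addr0.
Qed.

Lemma ideal_gen_morph (T : nzRingType) (f : {rmorphism S -> T}) gs h :
  (forall g, g \in gs -> f g = 0) -> ideal_gen gs h -> f h = 0.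
Proof.
elim: gs h => [|g gs IH] h hg; first by move=> ->; rewrite rmorph0.
move=> [h' [a [Ih' ->]]]; rewrite rmorphD rmorphM (hg g) ?inE ?eqxx // mulr0 addr0.
by apply: IH => // g' g'gs; apply: hg; rewrite inE g'gs orbT.
Qed.

Definition mnm_coprime m u := [forall i, (m i == 0%N) || (u i == 0%N)].

(** The monomial ideal generated by the leading monomials of [gs]. *)
Definition lead_above (gs : seq S) m : Prop := has (fun g => wlead g <= m)%MM gs.

Definition coprime_leads (gs : seq S) :=
  all (fun g => g != 0) gs && pairwise (fun g h => mnm_coprime (wlead h) (wlead g)) gs.

Lemma coprime_leads_cons g gs : g != 0 ->
  all (fun h => mnm_coprime (wlead h) (wlead g)) gs -> coprime_leads gs ->
  coprime_leads (g :: gs).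
Proof. by rewrite /coprime_leads /= => -> -> /andP[-> ->]. Qed.

Lemma coprime_leads_behead g gs : coprime_leads (g :: gs) -> coprime_leads gs.
Proof. by rewrite /coprime_leads /= => /andP[/andP[_ ->] /andP[_ ->]]. Qed.

Lemma lead_above_coprime gs g m :
  all (fun h => mnm_coprime (wlead h) (wlead g)) gs ->
  lead_above gs (m + wlead g)%MM -> lead_above gs m.
Proof.
move=> cop /hasP[h hgs /mnm_lepP le]; apply/hasP; exists h => //.
apply/mnm_lepP => i; move: (le i); rewrite mnmDE.
by have /forallP/(_ i)/orP[/eqP->//|/eqP->] := allP cop h hgs; rewrite addn0.
Qed.

(* Buchberger's criterion: the leading monomials of elements with pairwise coprime
   leading monomials generate the initial ideal. *)
Lemma coprime_lead_set gs : coprime_leads gs -> lead_set (ideal_gen gs) (lead_above gs).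
Proof.
elim: gs => [|g gs IH].
  by move=> _; split=> // [|h ->]; [apply: (@ideal_gen_is_ideal [::]) | rewrite eqxx].
move=> /andP[/= /andP[g0 n0] /andP[cop pw]].
have /IH LS : coprime_leads gs by rewrite /coprime_leads n0.
have [h1 h2 h3] := lead_set_add LS g0 (fun m => @lead_above_coprime gs g m cop).
split=> // [h Ih h0|m /orP[le|P]].
- by apply/orP; have [P|->] := h2 h Ih h0; [right|left].
- by apply: h3; right.
- by apply: h3; left.
Qed.

(** Regular sequences are read from the end of the list: each entry is regular modulo the entries
    after it. *)
Lemma coprime_lead_regular g gs a : coprime_leads (g :: gs) ->
  ideal_gen gs (a * g) -> ideal_gen gs a.
Proof.
move=> /andP[/= /andP[g0 n0] /andP[cop pw]].
have LS : lead_set (ideal_gen gs) (lead_above gs).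
  by apply: coprime_lead_set; rewrite /coprime_leads n0.
exact: (lead_regular LS g0 (fun m => @lead_above_coprime gs g m cop)).
Qed.

End WeightedLeadingMonomials.

(** * Gradings and determinants *)

Section GradedDeterminant.
Local Open Scope ring_scope.
Variables (R : comNzRingType) (D : zmodType) (H : D -> R -> Prop).
Hypothesis H0 : forall d, H d 0.
Hypothesis HD : forall d a b, H d a -> H d b -> H d (a + b).
Hypothesis HN : forall d a, H d a -> H d (- a).
Hypothesis H1 : H 0 1.
Hypothesis HM : forall d e a b, H d a -> H e b -> H (d + e) (a * b).

Lemma graded_sum (I : Type) (r : seq I) (P : pred I) d (F : I -> R) :
  (forall i, P i -> H d (F i)) -> H d (\sum_(i <- r | P i) F i).
Proof. by move=> h; elim/big_rec: _ => // i x Pi hx; apply: HD => //; apply: h. Qed.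

Lemma graded_prod (I : Type) (r : seq I) (d : I -> D) (F : I -> R) :
  (forall i, H (d i) (F i)) -> H (\sum_(i <- r) d i) (\prod_(i <- r) F i).
Proof. by move=> h; elim/big_rec2: _ => // i x y _ hx; apply: HM. Qed.

(** All terms of the expansion have the same degree, because a permutation only reorders the sum of
    the [b j]. *)
Lemma graded_det n (a b : 'I_n -> D) (M : 'M[R]_n) :
  (forall i j, H (a i - b j) (M i j)) -> H (\sum_i a i - \sum_j b j) (\det M).
Proof.
move=> h; apply: graded_sum => s _; rewrite -signr_odd.
suff h' : H (\sum_i a i - \sum_j b j) (\prod_i M i (s i)).
  by case: odd; rewrite ?expr1 ?expr0 ?mulN1r ?mul1r //; apply: HN.
rewrite [\sum_j b j](reindex_inj (@perm_inj _ s)) -sumrB.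
by apply: graded_prod => i; apply: h.
Qed.

Lemma graded_cofactor n (a b : 'I_n -> D) (M : 'M[R]_n) i0 j0 :
  (forall i j, H (a i - b j) (M i j)) ->
  H (\sum_i a i - a i0 - (\sum_j b j - b j0)) (cofactor M i0 j0).
Proof.
case: n a b M i0 j0 => [|n] a b M i0 j0 h; first by case: i0.
have e (c : 'I_n.+1 -> D) k : \sum_i c i - c k = \sum_i c (lift k i).
  by rewrite (bigD1_ord k) //= addrAC subrr add0r.
rewrite !e /cofactor -signr_odd.
suff h' : H (\sum_i a (lift i0 i) - \sum_j b (lift j0 j)) (\det (row' i0 (col' j0 M))).
  by case: odd; rewrite ?expr1 ?expr0 ?mulN1r ?mul1r //; apply: HN.
by apply: graded_det => i j; rewrite !mxE; apply: h.
Qed.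

End GradedDeterminant.

Section GradedPolynomials.
Local Open Scope ring_scope.
Variables (K : fieldType) (N : nat) (D : zmodType) (deg : 'I_N -> D).
Local Notation S := {mpoly K[N]}.

Definition mnm_grade (u : 'X_{1..N}) : D := \sum_k deg k *+ u k.
Definition graded (d : D) (p : S) := forall u, u \in msupp p -> mnm_grade u = d.

Lemma mnm_gradeD u v : mnm_grade (u + v)%MM = mnm_grade u + mnm_grade v.
Proof. by rewrite -big_split; apply: eq_bigr => k _; rewrite mnmDE mulrnDr. Qed.

Lemma mnm_grade1 k : mnm_grade U_(k)%MM = deg k.
Proof.
rewrite /mnm_grade (bigD1 k) //= mnm1E eqxx big1 ?addr0 // => j jk.
by rewrite mnm1E eq_sym (negPf jk).
Qed.

Lemma graded0 d : graded d 0.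
Proof. by move=> u; rewrite msupp0. Qed.

Lemma gradedD d p q : graded d p -> graded d q -> graded d (p + q).
Proof. by move=> hp hq u /msuppD_le; rewrite mem_cat => /orP[/hp|/hq]. Qed.

Lemma gradedN d p : graded d p -> graded d (- p).
Proof. by move=> hp u; rewrite (perm_mem (msuppN p)) => /hp. Qed.

Lemma gradedM d e p q : graded d p -> graded e q -> graded (d + e) (p * q).
Proof.
move=> hp hq u /msuppM_le /allpairsP[[a b] /= [ap bq ->]].
by rewrite mnm_gradeD hp ?hq.
Qed.

Lemma graded1 : graded 0 1.
Proof.
move=> u; rewrite msupp1 inE => /eqP->.
by rewrite /mnm_grade big1 // => k _; rewrite mnm0E.
Qed.

Lemma gradedX k : graded (deg k) 'X_k.
Proof. by move=> u; rewrite msuppX inE => /eqP->; rewrite mnm_grade1. Qed.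

(* The indeterminate of [{poly S}] is given the degree [t]. *)
Definition pgraded (t d : D) (P : {poly S}) := forall k, graded (d - t *+ k) P`_k.

Variable t : D.

Lemma pgraded0 d : pgraded t d 0.
Proof. by move=> k; rewrite coef0; apply: graded0. Qed.

Lemma pgradedD d p q : pgraded t d p -> pgraded t d q -> pgraded t d (p + q).
Proof. by move=> hp hq k; rewrite coefD; apply: gradedD. Qed.

Lemma pgradedN d p : pgraded t d p -> pgraded t d (- p).
Proof. by move=> hp k; rewrite coefN; apply: gradedN. Qed.

Lemma pgradedC d p : graded d p -> pgraded t d p%:P.
Proof.
by move=> hp k; rewrite coefC; case: eqP => [->|_]; rewrite ?mulr0n ?subr0 //; apply: graded0.
Qed.

Lemma pgraded1 : pgraded t 0 1.
Proof. by rewrite -polyC1; apply/pgradedC/graded1. Qed.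

Lemma pgradedX : pgraded t t 'X.
Proof.
move=> k; rewrite coefX; case: eqP => [->|_]; last exact: graded0.
by rewrite subrr; apply: graded1.
Qed.

Lemma pgradedM d e p q : pgraded t d p -> pgraded t e q -> pgraded t (d + e) (p * q).
Proof.
move=> hp hq k; rewrite coefM; apply: graded_sum => // [|a b c|i _].
- exact: graded0.
- exact: gradedD.
- have -> : d + e - t *+ k = d - t *+ i + (e - t *+ (k - i)).
    rewrite addrACA -opprD -mulrnDr subnKC //.
    by rewrite -ltnS.
  exact: gradedM.
Qed.

Definition pgraded_det := graded_det pgraded0 pgradedD pgradedN pgraded1 pgradedM.
Definition pgraded_cofactor :=
  graded_cofactor pgraded0 pgradedD pgradedN pgraded1 pgradedM.
Definition mpoly_graded_det := graded_det graded0 gradedD gradedN graded1 gradedM.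

End GradedPolynomials.

(** * The characteristic polynomial as a function of the first row *)

Section FirstRowCofactors.
Local Open Scope ring_scope.
Variables (R : comNzRingType) (m : nat).
Implicit Types A B : 'M[R]_m.+1.

Definition row_cof A (j : 'I_m.+1) : {poly R} := cofactor (char_poly_mx A) ord0 j.
Definition row_cof_mx A : 'M[R]_m.+1 := \matrix_(j, k) (row_cof A j)`_k.
(* On a nilpotent matrix, this is up to sign the determinant of e, A e, ..., A^m e for
   the first basis vector e. *)
Definition cyc_det A : R := \det (row_cof_mx A).
Definition row_rhs A : 'rV[R]_m.+1 := \row_k ('X * row_cof A ord0)`_k.

Lemma char_poly_row0 A :
  char_poly A = 'X * row_cof A ord0 - \sum_j (A ord0 j)%:P * row_cof A j.
Proof.
rewrite /char_poly (expand_det_row _ ord0).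
transitivity (\sum_j (('X *+ (j == ord0)) * row_cof A j - (A ord0 j)%:P * row_cof A j)).
  by apply: eq_bigr => j _; rewrite !mxE -mulrBl eq_sym.
rewrite sumrB; congr (_ - _); rewrite (bigD1 ord0) //= big1 ?addr0 // => j j0.
by rewrite (negPf j0) mul0r.
Qed.

(* The coefficients of the characteristic polynomial are affine functions of the
   first row; [row_cof_mx] is the matrix of this linear system. *)
Lemma row0_system A :
  row ord0 A *m row_cof_mx A = row_rhs A - \row_(k < m.+1) (char_poly A)`_k.
Proof.
apply/rowP => k; rewrite !mxE char_poly_row0 coefB opprB addrC subrK coef_sum.
by apply: eq_bigr => j _; rewrite !mxE coefCM.
Qed.

Lemma row0_cramer A :
  cyc_det A *: row ord0 A =
  (row_rhs A - \row_(k < m.+1) (char_poly A)`_k) *m \adj (row_cof_mx A).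
Proof. by rewrite -row0_system -mulmxA mul_mx_adj mul_mx_scalar. Qed.

Lemma row_cof_eq A B : (forall i j, i != ord0 -> A i j = B i j) ->
  row_cof A =1 row_cof B.
Proof.
move=> h j; rewrite /row_cof /cofactor; congr (_ * \det _).
by apply/matrixP => i k; rewrite !mxE h // eq_sym neq_lift.
Qed.

Lemma row_cof_mx_eq A B : (forall i j, i != ord0 -> A i j = B i j) ->
  row_cof_mx A = row_cof_mx B.
Proof. by move=> h; apply/matrixP => j k; rewrite !mxE (row_cof_eq h). Qed.

Lemma row_rhs_eq A B : (forall i j, i != ord0 -> A i j = B i j) ->
  row_rhs A = row_rhs B.
Proof. by move=> h; apply/rowP => k; rewrite !mxE (row_cof_eq h). Qed.

Lemma cyc_det_eq A B : (forall i j, i != ord0 -> A i j = B i j) ->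
  cyc_det A = cyc_det B.
Proof. by move=> h; rewrite /cyc_det (row_cof_mx_eq h). Qed.

Lemma char_poly_eqXn A :
  (forall k : 'I_m.+1, (char_poly A)`_k = 0) -> char_poly A = 'X^(m.+1).
Proof.
move=> h; apply/polyP => k; rewrite coefXn.
have [ltk|] := ltnP k m.+1.
  by rewrite (h (Ordinal ltk)) ltn_eqF.
rewrite leq_eqVlt => /orP[/eqP <-|ltk].
  by rewrite eqxx; move/monicP: (char_poly_monic A); rewrite lead_coefE size_char_poly.
by rewrite nth_default ?size_char_poly // gtn_eqF.
Qed.

End FirstRowCofactors.

Section MapFirstRowCofactors.
Local Open Scope ring_scope.
Variables (R R' : comNzRingType) (f : {rmorphism R -> R'}) (m : nat).
Implicit Types A : 'M[R]_m.+1.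

Lemma map_row_cof A j : row_cof (map_mx f A) j = map_poly f (row_cof A j).
Proof. by rewrite /row_cof -map_char_poly_mx cofactor_map_mx. Qed.

Lemma map_row_cof_mx A : row_cof_mx (map_mx f A) = map_mx f (row_cof_mx A).
Proof. by apply/matrixP => j k; rewrite !mxE map_row_cof coef_map. Qed.

Lemma map_cyc_det A : cyc_det (map_mx f A) = f (cyc_det A).
Proof. by rewrite /cyc_det map_row_cof_mx det_map_mx. Qed.

Lemma map_row_rhs A : row_rhs (map_mx f A) = map_mx f (row_rhs A).
Proof.
apply/rowP => k; rewrite !mxE map_row_cof.
by rewrite -[X in X * _](map_polyX f) -rmorphM coef_map.
Qed.

Lemma coef_map_char_poly A k : (char_poly (map_mx f A))`_k = f (char_poly A)`_k.
Proof. by rewrite -map_char_poly coef_map. Qed.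

End MapFirstRowCofactors.

(** * The cyclicity determinant of a subdiagonal matrix *)

Section SubdiagonalMatrix.
Local Open Scope ring_scope.
Variables (R : idomainType) (m : nat) (s : nat -> R).

Definition subdiag_mx : 'M[R]_m.+1 := \matrix_(i, j) (s j *+ (i == j.+1 :> nat)).

Definition subdiag_prod (j : nat) := \prod_(l < j) s l.

(** The cofactors form the first column of the adjugate of M. The explicit column v satisfies M v =
    x^(m+1) e_0, and multiplying by the adjugate identifies it with that column, since det M =
    x^(m+1) can be cancelled. *)
Lemma row_cof_subdiag (j : 'I_m.+1) :
  row_cof subdiag_mx j = (subdiag_prod j)%:P * 'X^(m - j).
Proof.
set M := char_poly_mx subdiag_mx.
have Mtrig : is_trig_mx M.
  apply/is_trig_mxP => i k ltik; rewrite !mxE -val_eqE (ltn_eqF ltik).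
  by rewrite (ltn_eqF (ltnW ltik : (i < k.+1)%N)) mulr0n subrr.
have detM : \det M = 'X^(m.+1).
  rewrite det_trig // (eq_bigr (fun=> 'X)) ?prodr_const ?card_ord // => i _.
  by rewrite !mxE eqxx ltn_eqF // mulr0n subr0.
pose v : 'cV[{poly R}]_m.+1 := \col_i ((subdiag_prod i)%:P * 'X^(m - i)).
have Mv : M *m v = \col_i ('X^(m.+1) *+ (i == ord0)).
  apply/colP => i; rewrite !mxE (bigD1 i) //= !mxE eqxx (ltn_eqF (leqnn _)) mulr0n subr0.
  case: (unliftP ord0 i) => [l ->|->]; last first.
    rewrite /subdiag_prod big_ord0 mul1r -exprS subn0 big1 ?addr0 // => k k0.
    by rewrite !mxE eq_sym (negPf k0) /= subr0 mul0r.
  have ne : widen_ord (leqnSn m) l != lift ord0 l.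
    by rewrite -val_eqE /= /bump /= neq_ltn add1n ltnS leqnn.
  rewrite (bigD1 (widen_ord (leqnSn m) l)) //= big1 ?addr0 => [|k /andP[k1 k2]].
    rewrite !mxE eq_sym (negPf ne) /= /bump /= add1n eqxx mulr0n sub0r mulr1n.
    rewrite {1}/subdiag_prod big_ord_recr /= -/(subdiag_prod l) polyCM.
    have -> : 'X^(m - l) = 'X * 'X^(m - l.+1) :> {poly R}.
      by rewrite -exprS subnSK.
    by rewrite mulr1n mulr0n; ring.
  rewrite !mxE eq_sym (negPf k1) /= /bump /= add1n eqSS.
  rewrite -[nat_of_ord l]/(nat_of_ord (widen_ord (leqnSn m) l)) val_eqE eq_sym (negPf k2).
  by rewrite mulr0n subrr mul0r.
have e : \adj M *m (M *m v) = 'X^(m.+1) *: v by rewrite mulmxA mul_adj_mx detM mul_scalar_mx.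
have := congr1 (fun u : 'cV_m.+1 => u j ord0) e; rewrite Mv !mxE.
rewrite (bigD1 ord0) //= !mxE eqxx big1 ?addr0 => [|k k0]; last first.
  by rewrite !mxE (negPf k0) mulr0.
by rewrite mulrC; apply: mulfI; rewrite expf_neq0 // polyX_eq0.
Qed.

(** Row j of the cofactor matrix has its only entry in column m - j, so the matrix is a diagonal one
    times the reversal permutation. *)
Lemma cyc_det_subdiag :
  exists b : bool, cyc_det subdiag_mx = (-1) ^+ b * \prod_(j < m.+1) subdiag_prod j.
Proof.
pose r : 'S_m.+1 := perm (@rev_ord_inj m.+1); exists (odd_perm r).
have -> : cyc_det subdiag_mx = \det (diag_mx (\row_j subdiag_prod j) *m perm_mx r).
  congr (\det _); apply/matrixP => j k; rewrite !mxE row_cof_subdiag coefCM coefXn.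
  rewrite (bigD1 j) //= !mxE eqxx mulr1n big1 ?addr0 => [|i ij]; last first.
    by rewrite !mxE eq_sym (negPf ij) mulr0n mul0r.
  by rewrite permE -val_eqE /= subSS eq_sym.
rewrite det_mulmx det_diag det_perm mulrC; congr (_ * _).
by apply: eq_bigr => j _; rewrite mxE.
Qed.

End SubdiagonalMatrix.

(** * A monomial order adapted to the diagonals of a matrix *)

Section SlopeWeights.
Local Open Scope ring_scope.
Variables (K : fieldType) (m : nat).
Local Notation n := m.+1.
Local Notation S := {mpoly K[n * n]}.
Local Notation ix := (@mxvec_index n n).
Implicit Types (u v : 'X_{1..n * n}) (p : S).

Definition ix_row (k : 'I_(n * n)) : nat := mxvec (\matrix_(i < n, j < n) (i : nat)) ord0 k.
Definition slope (k : 'I_(n * n)) : int :=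
  mxvec (\matrix_(i < n, j < n) (i%:Z - j%:Z)) ord0 k.

Lemma ix_rowE i j : ix_row (ix i j) = i.
Proof. by rewrite /ix_row mxvecE mxE. Qed.

Lemma slopeE i j : slope (ix i j) = i%:Z - j%:Z.
Proof. by rewrite /slope mxvecE mxE. Qed.

(** Exceeds the row sum of every monomial of degree at most n^2, so the tie-break by rows never
    outweighs the slopes. *)
Definition big_weight := (n ^ 3).+1.
(* The weight is strictly concave in the slope: among the monomials of a given degree and
   total slope, those supported on a single diagonal get the largest weight. The row index
   breaks the ties between the latter. *)
Definition weight (k : 'I_(n * n)) : nat :=
  (big_weight * (n ^ 2 - `|slope k| ^ 2) + ix_row k)%N.

Lemma slope_lt k : (`|slope k| < n)%N.
Proof.
by case/mxvec_indexP: k => i j; rewrite slopeE; have := ltn_ord i; have := ltn_ord j; lia.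
Qed.

Lemma weight_gt0 k : (0 < weight k)%N.
Proof.
rewrite /weight addn_gt0 muln_gt0 subn_gt0 /=.
by rewrite ltn_exp2r // slope_lt.
Qed.

Lemma weight_int k :
  (weight k)%:Z = big_weight%:Z * (n%:Z ^+ 2 - slope k ^+ 2) + (ix_row k)%:Z.
Proof.
rewrite /weight PoszD PoszM -subzn; last first.
  by rewrite leq_exp2r // ltnW // slope_lt.
rewrite -abszX gez0_abs ?sqr_ge0 //; congr (_ * (_ - _) + _).
Qed.

Definition grade_wt (k : 'I_(n * n)) : int * int := (1, slope k).
Definition on_slope (s : int) u := [forall k, (u k != 0%N) ==> (slope k == s)].
Definition row_sum u : nat := (\sum_k u k * ix_row k)%N.

Lemma grade_fst u : (mnm_grade grade_wt u).1 = \sum_k (u k)%:Z.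
Proof.
rewrite /mnm_grade raddf_sum; apply: eq_bigr => k _.
by rewrite raddfMn /= -mulr_natr mul1r natz.
Qed.

Lemma grade_snd u : (mnm_grade grade_wt u).2 = \sum_k (u k)%:Z * slope k.
Proof.
rewrite /mnm_grade raddf_sum; apply: eq_bigr => k _.
by rewrite raddfMn /= -mulr_natr natz mulrC.
Qed.

(** Completing the square around the mean slope s. The middle term is a variance, which vanishes
    exactly on the monomials supported on the diagonal of slope s. *)
Lemma wdeg_int u (d s : int) : mnm_grade grade_wt u = (d, s * d) ->
  (wdeg weight u)%:Z = big_weight%:Z * (n%:Z ^+ 2 - s ^+ 2) * d
    - big_weight%:Z * (\sum_k (u k)%:Z * (slope k - s) ^+ 2) + (row_sum u)%:Z.
Proof.
move=> g; have := congr1 fst g; have := congr1 snd g.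
rewrite grade_fst grade_snd /= => e2 e1.
have -> : (wdeg weight u)%:Z = \sum_k (weight k)%:Z * (u k)%:Z.
  by rewrite /wdeg (big_morph Posz PoszD (erefl _)); apply: eq_bigr => k _; rewrite PoszM.
have -> : (row_sum u)%:Z = \sum_k (u k)%:Z * (ix_row k)%:Z.
  by rewrite /row_sum (big_morph Posz PoszD (erefl _)); apply: eq_bigr => k _; rewrite PoszM.
have e3 : \sum_k (u k)%:Z * (slope k - s) ^+ 2 =
    \sum_k (u k)%:Z * slope k ^+ 2 - s ^+ 2 * d.
  transitivity (\sum_k ((u k)%:Z * slope k ^+ 2 - (2 * s) * ((u k)%:Z * slope k)
      + s ^+ 2 * (u k)%:Z)).
    by apply: eq_bigr => k _; ring.
  by rewrite big_split sumrB -!mulr_sumr /= e1 e2; ring.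
rewrite e3; transitivity (\sum_k (big_weight%:Z * n%:Z ^+ 2 * (u k)%:Z -
    big_weight%:Z * ((u k)%:Z * slope k ^+ 2) + (u k)%:Z * (ix_row k)%:Z)).
  by apply: eq_bigr => k _; rewrite weight_int; ring.
by rewrite big_split sumrB -!mulr_sumr /= e1; ring.
Qed.

Lemma row_sum_le u : (row_sum u <= mdeg u * n)%N.
Proof.
rewrite mdegE big_distrl; apply: leq_sum => k _ /=; rewrite leq_mul2l.
by apply/orP; right; case/mxvec_indexP: k => i j; rewrite ix_rowE ltnW.
Qed.

(** A monomial off the diagonal of slope s has variance at least 1, which costs [big_weight], more
    than its row sum can make up for. On the diagonal the row sums decide. *)
Lemma wlead_slope p u0 (d : nat) (s : int) : (d <= n ^ 2)%N ->
  graded grade_wt (d%:Z, s * d%:Z) p -> p@_u0 != 0 -> on_slope s u0 ->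
  (forall u, u \in msupp p -> on_slope s u -> u != u0 -> (row_sum u < row_sum u0)%N) ->
  wlead weight p = u0.
Proof.
move=> dn gp pu0 os0 h; apply: wlead_top => //; first exact: weight_gt0.
move=> u up neq; have gu := gp u up.
have gu0 : mnm_grade grade_wt u0 = (d%:Z, s * d%:Z) by apply: gp; rewrite mcoeff_msupp.
rewrite -ltz_nat (wdeg_int gu) (wdeg_int gu0).
have V0 : \sum_k (u0 k)%:Z * (slope k - s) ^+ 2 = 0.
  rewrite big1 // => k _; have [->|nz] := eqVneq (u0 k) 0%N; first by rewrite mul0r.
  by have /forallP/(_ k) := os0; rewrite nz /= => /eqP->; rewrite subrr expr0n mulr0.
rewrite V0 mulr0 subr0 -addrA ltrD2l.
have [os|nos] := boolP (on_slope s u).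
  rewrite big1 ?mulr0 ?oppr0 ?add0r ?ltz_nat; first exact: h.
  move=> k _; have [->|nz] := eqVneq (u k) 0%N; first by rewrite mul0r.
  by have /forallP/(_ k) := os; rewrite nz /= => /eqP->; rewrite subrr expr0n mulr0.
have md : mdeg u = d.
  have := congr1 fst gu; rewrite grade_fst /= => e; apply/eqP; rewrite -eqz_nat -e.
  by rewrite mdegE (big_morph Posz PoszD (erefl _)).
have V1 : 1 <= \sum_k (u k)%:Z * (slope k - s) ^+ 2.
  move: nos; rewrite negb_forall => /existsP[k]; rewrite negb_imply => /andP[uk sk].
  rewrite (bigD1 k) //= -[1]addr0 lerD //; last first.
    by apply: sumr_ge0 => j _; rewrite mulr_ge0 ?sqr_ge0.
  rewrite -gtz0_ge1 mulr_gt0 //; first by rewrite ltz_nat lt0n.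
  by rewrite lt_neqAle sqr_ge0 eq_sym sqrf_eq0 subr_eq0 sk.
have le : (row_sum u <= n ^ 3)%N.
  by rewrite (leq_trans (row_sum_le u)) // md expnSr leq_mul2r dn orbT.
have : big_weight%:Z * 1 <= big_weight%:Z * \sum_k (u k)%:Z * (slope k - s) ^+ 2.
  by rewrite ler_wpM2l.
move: le; rewrite /big_weight -lez_nat; move: (n ^ 3)%N (row_sum u) (row_sum u0) => a b c.
move: (_ * \sum_k _) => V; lia.
Qed.

End SlopeWeights.

(** * Divided differences *)

Section NewtonInterpolation.
Local Open Scope ring_scope.

(* [newton b k j] is the complete homogeneous symmetric polynomial of degree
   [j - k] in [b 0, ..., b k], i.e. the divided difference of 'X^j at these nodes. *)
Fixpoint newton (R : comNzRingType) (b : nat -> R) (k j : nat) {struct j} : R :=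
  if j is j'.+1 then
    (if k is k'.+1 then newton b k' j' else 0) + b k * newton b k j'
  else (k == 0%N)%:R.

Variables (R : comNzRingType) (b : nat -> R).

Lemma newton_lt k j : (j < k)%N -> newton b k j = 0.
Proof.
elim: j k => [|j IH] [|k] //= ltjk.
by rewrite !IH ?mulr0 ?addr0 // ltnW.
Qed.

Lemma newton_diag k : newton b k k = 1.
Proof. by elim: k => //= k ->; rewrite newton_lt // mulr0 addr0. Qed.

Lemma newtonS k j :
  newton b k j.+1 = (if k is k'.+1 then newton b k' j else 0) + b k * newton b k j.
Proof. by []. Qed.

Arguments newton : simpl never.

Definition divdiff (k : nat) (p : {poly R}) := \sum_(j < size p) p`_j * newton b k j.

Lemma divdiff_wide k (p : {poly R}) N : (size p <= N)%N ->
  divdiff k p = \sum_(j < N) p`_j * newton b k j.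
Proof.
move=> le; rewrite /divdiff (big_ord_widen _ (fun j => p`_j * newton b k j) le) big_mkcond.
apply: eq_bigr => j _; case: ltnP => // gej; by rewrite nth_default ?mul0r.
Qed.

Lemma divdiffM k (p : {poly R}) :
  divdiff k (p * ('X - (b k)%:P)) = if k is k'.+1 then divdiff k' p else 0.
Proof.
set N := size p.
rewrite (@divdiff_wide _ _ N.+1); last first.
  by rewrite (leq_trans (size_polyMleq _ _)) // size_XsubC addn2.
transitivity (\sum_(j < N) p`_j * (newton b k j.+1 - b k * newton b k j)).
  have -> : \sum_(j < N.+1) (p * ('X - (b k)%:P))`_j * newton b k j =
      \sum_(j < N.+1) (p * 'X)`_j * newton b k j - \sum_(j < N.+1) p`_j * b k * newton b k j.
    rewrite -sumrB; apply: eq_bigr => j _.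
    by rewrite mulrBr coefB coefMC mulrBl.
  rewrite big_ord_recl coefMX eqxx mul0r add0r [X in _ - X]big_ord_recr /=.
  rewrite nth_default // !mul0r addr0 -sumrB; apply: eq_bigr => j _.
  by rewrite coefMX /=; ring.
case: k => [|k].
  by rewrite big1 // => j _; rewrite newtonS add0r subrr mulr0.
by rewrite /divdiff -/N; apply: eq_bigr => j _; rewrite newtonS addrK.
Qed.

(** The nodes b 0, ..., b k are all roots; [divdiffM] peels off their factors, starting with the
    last node. *)
Lemma divdiff_prod0 k N : (k < N)%N -> divdiff k (\prod_(i < N) ('X - (b i)%:P)) = 0.
Proof.
suff h k' q : divdiff k' (q * \prod_(i < k'.+1) ('X - (b i)%:P)) = 0.
  move=> ltkN; rewrite -(subnKC ltkN) big_split_ord /= mulrC; exact: h.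
elim: k' q => [|k' IH] q; by rewrite big_ord_recr mulrA divdiffM.
Qed.

End NewtonInterpolation.

Lemma map_newton (R R' : comNzRingType) (f : {rmorphism R -> R'}) (b : nat -> R) k j :
  f (newton b k j) = newton (fun i => f (b i)) k j.
Proof.
elim: j k => [|j IH] k; first exact: rmorph_nat.
by rewrite !newtonS rmorphD rmorphM IH; case: k => [|k]; rewrite ?rmorph0 ?IH.
Qed.

Arguments newton : simpl never.

(** * Restriction of polynomials to one diagonal *)

Section Specialization.
Local Open Scope ring_scope.
Variables (K : fieldType) (m : nat).
Local Notation n := m.+1.
Local Notation S := {mpoly K[n * n]}.
Local Notation ix := (@mxvec_index n n).
Implicit Types (u v : 'X_{1..n * n}) (p : S).

(** As a ring morphism, the restriction to one diagonal commutes with determinants: the candidates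
    for leading terms can be computed on sparse matrices. *)
Definition slope_part (s : int) : S -> S :=
  comp_mpoly [tuple (if slope k == s then 'X_k else 0) | k < n * n].
HB.instance Definition _ s := GRing.RMorphism.on (slope_part s).

Lemma slope_partX s k : slope_part s 'X_k = if slope k == s then 'X_k else 0.
Proof. by rewrite /slope_part comp_mpolyXU -tnth_nth tnth_mktuple. Qed.

Lemma mcoeff_slope_part s p u :
  (slope_part s p)@_u = if on_slope s u then p@_u else 0.
Proof.
have e v : slope_part s 'X_[v] = if on_slope s v then 'X_[v] else 0.
  rewrite /slope_part comp_mpolyX; case: ifPn => os.
    rewrite [RHS]mpolyXE_id; apply: eq_bigr => k _; rewrite tnth_mktuple.
    have [->|vk] := eqVneq (v k) 0%N; first by rewrite !expr0.
    by have /forallP/(_ k) := os; rewrite vk /= => ->.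
  move: os; rewrite negb_forall => /existsP[k]; rewrite negb_imply => /andP[vk sk].
  by rewrite (bigD1 k) //= tnth_mktuple (negPf sk) expr0n (negPf vk) mul0r.
elim/mpolyind: p => [|c v p _ _ IH].
  by rewrite rmorph0 !mcoeff0; case: ifP.
rewrite rmorphD mcoeffD IH mcoeffD -mul_mpolyC rmorphM /= e.
rewrite {1}/slope_part comp_mpolyC !mcoeffCM.
case: (boolP (on_slope s v)) => osv; rewrite ?mcoeffX.
  case: (boolP (on_slope s u)) => // osu.
  by case: eqP osv osu => [-> ->|_ _ _] //=; rewrite mulr0 addr0.
rewrite mcoeff0 mulr0 add0r; case: (boolP (on_slope s u)) => // osu.
by case: eqP osv osu => [-> /negPf->|_ _ _] //=; rewrite mulr0 add0r.
Qed.

Lemma on_slope_coprime s t u v : on_slope s u -> on_slope t v -> s != t ->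
  mnm_coprime u v.
Proof.
move=> /forallP hu /forallP hv ne; apply/forallP => k.
move: (hu k) (hv k).
have [//|_ /= /eqP->] := eqVneq (u k) 0%N; have [//|_ /= /eqP e] := eqVneq (v k) 0%N.
by rewrite e eqxx in ne.
Qed.

Lemma row_sumD u v : row_sum (u + v)%MM = (row_sum u + row_sum v)%N.
Proof. by rewrite -big_split; apply: eq_bigr => k _; rewrite mnmDE mulnDl. Qed.

Lemma row_sum1 (k : 'I_(n * n)) : row_sum U_(k)%MM = ix_row k.
Proof.
rewrite /row_sum (bigD1 k) //= mnm1E eqxx mul1n big1 ?addn0 // => j jk.
by rewrite mnm1E eq_sym (negPf jk).
Qed.

Lemma row_sum0 : row_sum (0%MM : 'X_{1..n * n}) = 0%N.
Proof. by apply: big1 => k _; rewrite mnm0E. Qed.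

Lemma row_sumMn u d : row_sum (u *+ d)%MM = (row_sum u * d)%N.
Proof. by rewrite /row_sum big_distrl; apply: eq_bigr => k _; rewrite mulmnE mulnAC. Qed.

End Specialization.

(** * Leading monomials of the equations of the nilpotent cone *)

Section NilpotentIdeal.
Local Open Scope ring_scope.
Variables (K : fieldType) (m : nat).
Local Notation n := m.+1.
Local Notation S := {mpoly K[n * n]}.
Local Notation ix := (@mxvec_index n n).
Local Notation grade := (graded (@grade_wt m)).
Implicit Types (u v : 'X_{1..n * n}) (p : S).

(* [b] tells whether the generic matrix is transposed. *)
Definition ixt (b : bool) (i j : 'I_n) := if b then ix j i else ix i j.
Definition generic_mx (b : bool) : 'M[S]_n := \matrix_(i, j) 'X_(ixt b i j).
Definition sgb (b : bool) : int := if b then -1 else 1.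

Lemma slope_ixt b (i j : 'I_n) : slope (ixt b i j) = sgb b * (i%:Z - j%:Z).
Proof. by case: b; rewrite slopeE ?mul1r // mulN1r opprB. Qed.

(** The indeterminate has degree 1 and slope 0. The degree is charged to the rows and the slope to
    both rows and columns, so the slopes cancel in the determinant. *)
Lemma graded_char_poly_mx b (i j : 'I_n) :
  pgraded (@grade_wt m) (1, 0) ((1, sgb b * i%:Z) - (0, sgb b * j%:Z))
    (char_poly_mx (generic_mx b) i j).
Proof.
have -> : (1, sgb b * i%:Z) - (0, sgb b * j%:Z) = grade_wt (ixt b i j).
  by rewrite /grade_wt slope_ixt mulrBr; congr (_, _); rewrite subr0.
rewrite !mxE; apply: pgradedD; last by apply/pgradedN/pgradedC/gradedX.
case: eqP => [->|_]; last exact: pgraded0.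
by rewrite /grade_wt slope_ixt subrr mulr0; apply: pgradedX.
Qed.

Definition cp_coef (k : nat) : S := (char_poly (generic_mx false))`_k.

Lemma graded_cp_coef k : grade (n%:Z - k%:Z, 0) (cp_coef k).
Proof.
have /(_ k) := pgraded_det (@graded_char_poly_mx false).
congr graded; rewrite [LHS]surjective_pairing; congr (_, _).
  rewrite !raddfB !raddf_sum /= raddfMn /= sumr_const card_ord big1 // subr0.
  by rewrite !natz.
rewrite !raddfB !raddf_sum /= raddfMn /= mul0rn subr0.
by rewrite -big_split big1 // => i _; rewrite /= subrr.
Qed.

Definition diag_var (i : nat) : S := 'X_(ix (inord i) (inord i)).

Lemma graded_diag_var i : grade (1, 0) (diag_var i).
Proof.
have -> : (1, 0) = grade_wt (ix (inord i) (inord i)) by rewrite /grade_wt slopeE subrr.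
exact: gradedX.
Qed.

Lemma graded_newton k j : grade (j%:Z - k%:Z, 0) (newton diag_var k j).
Proof.
elim: j k => [|j IH] [|k]; rewrite ?newtonS.
- by rewrite subrr; apply: graded1.
- exact: graded0.
- have -> : (j.+1%:Z - 0, 0) = (1, 0) + (j%:Z - 0, 0) :> _ * int.
    by congr (_, _); rewrite /= ?addr0 //; lia.
  by rewrite add0r; apply: gradedM (IH 0%N); apply: graded_diag_var.
- have -> : (j.+1%:Z - k.+1%:Z, 0) = (j%:Z - k%:Z, 0) :> _ * int.
    by congr (_, _); lia.
  apply: gradedD => //.
  have -> : (j%:Z - k%:Z, 0) = (1, 0) + (j%:Z - k.+1%:Z, 0) :> _ * int.
    by congr (_, _); rewrite /= ?addr0 //; lia.
  by apply: gradedM (IH _); apply: graded_diag_var.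
Qed.

(* The divided difference of [char_poly - 'X^n] at the diagonal entries 0, ..., k. Its part
   supported on the diagonal is up to sign a complete homogeneous symmetric polynomial,
   whose leading monomial is a pure power. *)
Definition nil_gen (k : nat) : S := \sum_(j < n) cp_coef j * newton diag_var k j.

Lemma graded_nil_gen k : (k < n)%N -> grade ((n - k)%N%:Z, 0 * (n - k)%N%:Z) (nil_gen k).
Proof.
move=> ltkn; apply: graded_sum => [|a b|j _].
- exact: graded0.
- exact: gradedD.
have -> : ((n - k)%N%:Z, 0 * (n - k)%N%:Z) = (n%:Z - j%:Z, 0) + (j%:Z - k%:Z, 0) :> _ * int.
  have e : (n - k)%N%:Z = n%:Z - j%:Z + (j%:Z - k%:Z) by move: ltkn; lia.
  by rewrite mul0r e; congr (_, _); rewrite /= addr0.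
by apply: gradedM; [apply: graded_cp_coef | apply: graded_newton].
Qed.

Lemma slope_part_diag_var i : slope_part 0 (diag_var i) = diag_var i.
Proof. by rewrite slope_partX slopeE subrr eqxx. Qed.

(** On the diagonal the characteristic polynomial becomes the product of the x - a_i, whose divided
    difference at a_0, ..., a_k vanishes. The sum in [nil_gen] stops before x^n, whose contribution
    is therefore left with a minus sign. *)
Lemma slope_part_nil_gen k : (k < n)%N ->
  slope_part 0 (nil_gen k) = - newton diag_var k n.
Proof.
move=> ltkn; rewrite rmorph_sum /=.
pose P := \prod_(i < n) ('X - (diag_var i)%:P).
have cpE : char_poly (map_mx (slope_part 0) (generic_mx false)) = P.
  rewrite char_poly_trig; last first.
    apply/is_trig_mxP => i j ltij; rewrite !mxE slope_partX slopeE.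
    by rewrite subr_eq0 eqz_nat ltn_eqF.
  apply: eq_bigr => i _; rewrite !mxE /= slope_partX slopeE subrr eqxx.
  by rewrite /diag_var inord_val.
have sP : size P = n.+1 by rewrite -cpE size_char_poly.
have := divdiff_prod0 diag_var ltkn; rewrite -/P /divdiff sP big_ord_recr /=.
have -> : P`_n = 1.
  rewrite -cpE.
  have /monicP := char_poly_monic (map_mx (slope_part 0) (generic_mx false)).
  by rewrite lead_coefE size_char_poly.
rewrite mul1r => /eqP; rewrite addr_eq0 => /eqP <-.
apply: eq_bigr => j _; rewrite rmorphM /= map_newton.
congr (_ * _); first by rewrite -cpE coef_map_char_poly.
by congr newton; apply: funext => i; apply: slope_part_diag_var.
Qed.

Definition nil_lead (k : 'I_n) d : 'X_{1..n * n} := (U_(ix k k) *+ d)%MM.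

Lemma on_slope_nil_lead k d : on_slope 0 (nil_lead k d).
Proof.
apply/forallP => j; apply/implyP; rewrite mulmnE mnm1E.
by have [<-|_] := eqVneq (ix k k) j; rewrite ?slopeE ?subrr.
Qed.

(** Row sums favour the last node, so the top monomial is the d-th power of a_k. The induction on k
    and d follows h_(d+1)(a_0..a_k) = h_(d+1)(a_0..a_(k-1)) + a_k h_d(a_0..a_k). *)
Lemma newton_top (k : 'I_n) d :
  (newton diag_var k (k + d))@_(nil_lead k d) = 1 /\
  forall u, u \in msupp (newton diag_var k (k + d)) ->
    (row_sum u <= k * d)%N /\ (u != nil_lead k d -> (row_sum u < k * d)%N).
Proof.
have rsl (l : 'I_n) e : row_sum (nil_lead l e) = (l * e)%N.
  by rewrite row_sumMn row_sum1 ix_rowE.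
have base : forall l : 'I_n, (newton diag_var l (l + 0))@_(nil_lead l 0) = 1 /\
  forall u, u \in msupp (newton diag_var l (l + 0)) ->
    (row_sum u <= l * 0)%N /\ (u != nil_lead l 0 -> (row_sum u < l * 0)%N).
  move=> l; rewrite addn0 newton_diag /nil_lead mulm0n mcoeff1 eqxx; split=> // u.
  by rewrite msupp1 inE => /eqP->; rewrite row_sum0 eqxx.
(* One step of the recursion: q comes from the earlier nodes, hence has smaller row sums. *)
have step (l : 'I_n) e (q r : S) :
    (forall u, u \in msupp q -> (row_sum u < l * e.+1)%N) ->
    r@_(nil_lead l e) = 1 /\ (forall u, u \in msupp r ->
      (row_sum u <= l * e)%N /\ (u != nil_lead l e -> (row_sum u < l * e)%N)) ->
    (q + diag_var l * r)@_(nil_lead l e.+1) = 1 /\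
    (forall u, u \in msupp (q + diag_var l * r) ->
      (row_sum u <= l * e.+1)%N /\ (u != nil_lead l e.+1 -> (row_sum u < l * e.+1)%N)).
  move=> hq [r1 hr]; rewrite /diag_var inord_val /nil_lead mulmS -/(nil_lead l e); split.
    rewrite mcoeffD mulrC mcoeffMX r1 [X in X + _](_ : _ = 0) ?add0r //.
    apply: memN_msupp_eq0; apply/negP => /hq.
    by rewrite -mulmS rsl ltnn.
  move=> u /msuppD_le; rewrite mem_cat => /orP[/hq lt|].
    by split; [apply: ltnW | move=> _].
  move=> /msuppM_le /allpairsP[[a v] /= [ai /hr[le lt] ->]].
  move: ai; rewrite msuppX inE => /eqP->.
  rewrite row_sumD row_sum1 ix_rowE mulnS leq_add2l ltn_add2l; split=> // ne.
  by apply: lt; apply: contraNneq ne => ->.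
have [l kl] : exists l : nat, l = k by eexists.
elim: l k kl d => [|l IH] k kl.
  elim=> [|d IHd]; first exact: base.
  rewrite -kl add0n newtonS -[in X in 0 + X](add0n d).
  have := @step k d 0 (newton diag_var k (k + d)).
  rewrite -kl; apply; first by move=> u; rewrite msupp0.
  by rewrite -kl in IHd.
have ltl : (l < n)%N by rewrite (ltn_trans (ltnSn l)) // kl.
elim=> [|d IHd]; first exact: base.
rewrite addnS newtonS -kl.
have := @step k d (newton diag_var l (l + d.+1)) (newton diag_var k (k + d)).
rewrite -kl addSn addnS; apply; last by rewrite -addSn kl.
move=> u; have [_ /(_ u)] := IH (Ordinal ltl) erefl d.+1; rewrite addnS => h /h[/= le _].
by rewrite (leq_ltn_trans le) // ltn_mul2r /= ltnSn.
Qed.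

Lemma wlead_nil_gen (k : 'I_n) :
  nil_gen k != 0 /\ wlead (@weight m) (nil_gen k) = nil_lead k (n - k).
Proof.
have ltk := ltn_ord k.
have [t1 t2] := newton_top k (n - k); rewrite subnKC ?(ltnW ltk) // in t1 t2.
have os := on_slope_nil_lead k (n - k).
have c0 : (nil_gen k)@_(nil_lead k (n - k)) = -1.
  have := mcoeff_slope_part 0 (nil_gen k) (nil_lead k (n - k)).
  by rewrite os slope_part_nil_gen // mcoeffN t1.
have nz : (nil_gen k)@_(nil_lead k (n - k)) != 0 by rewrite c0 oppr_eq0 oner_eq0.
split; first by apply: contra_neq nz => ->; rewrite mcoeff0.
apply: (wlead_slope (d := (n - k)%N) (s := 0)) => //.
- by rewrite (leq_trans (leq_subr _ _)) // leq_pmull.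
- exact: graded_nil_gen.
move=> u up osu ne; rewrite row_sumMn row_sum1 ix_rowE.
have /t2[_ -> //] : u \in msupp (newton diag_var k n).
rewrite mcoeff_msupp -oppr_eq0 -mcoeffN -slope_part_nil_gen //.
by rewrite mcoeff_slope_part osu -mcoeff_msupp.
Qed.

End NilpotentIdeal.

(** * The two cyclicity polynomials and their regularity *)

Section CyclicityPolynomials.
Local Open Scope ring_scope.
Variables (K : fieldType) (m : nat).
Local Notation n := m.+1.
Local Notation S := {mpoly K[n * n]}.
Local Notation ix := (@mxvec_index n n).
Local Notation grade := (graded (@grade_wt m)).
Implicit Types (u v : 'X_{1..n * n}) (p : S).

Definition cyc_poly (b : bool) : S := cyc_det (generic_mx K m b).
Definition cyc_deg : nat := (\sum_(i < n) i)%N.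

Lemma cyc_degE : (cyc_deg + cyc_deg = n * m)%N.
Proof.
rewrite /cyc_deg; elim: m => [|k IH]; first by rewrite big_ord1.
by rewrite big_ord_recr /= addnACA IH; lia.
Qed.

(** The entry in row j and column k has degree m - k and slope j up to sign; the degrees add up to n
    m - [cyc_deg], which is [cyc_deg]. *)
Lemma graded_cyc_poly b : grade (cyc_deg%:Z, sgb b * cyc_deg%:Z) (cyc_poly b).
Proof.
have h (j k : 'I_n) : grade ((m%:Z, sgb b * j%:Z) - (k%:Z, 0)) (row_cof_mx (generic_mx K m b) j k).
  rewrite mxE; have /(_ (k : nat)) :=
    pgraded_cofactor (i0 := ord0) (j0 := j) (@graded_char_poly_mx K m b).
  congr graded; rewrite [LHS]surjective_pairing [RHS]surjective_pairing; congr (_, _).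
    rewrite !(raddfB, raddf_sum) /= raddfMn /= sumr_const card_ord big1 // !subr0.
    by rewrite !natz; lia.
  rewrite !(raddfB, raddf_sum) /= raddfMn /= mul0rn !subr0 mulr0 subr0.
  by rewrite sumrN opprK addrA subrr add0r.
have := mpoly_graded_det h; congr graded.
have e := congr1 Posz cyc_degE; rewrite /cyc_deg PoszD PoszM in e.
have e' : \sum_(i < n) i%:Z = (\sum_(i < n) i)%N%:Z.
  by rewrite (big_morph Posz PoszD (erefl _)).
rewrite /cyc_deg [LHS]surjective_pairing; congr (_, _).
  rewrite !(raddfB, raddf_sum) /= sumr_const card_ord sumrN e' -[_ *+ _]mulr_natr natz.
  by move: e; lia.
by rewrite !(raddfB, raddf_sum) /= [X in _ + X]big1 // addr0 -mulr_sumr e'.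
Qed.

Definition cyc_lead (b : bool) : 'X_{1..n * n} :=
  (\sum_(j < n) \sum_(l < j) U_(ixt b (inord l.+1) (inord l)))%MM.

Lemma on_slope_cyc_lead b : on_slope (sgb b) (cyc_lead b).
Proof.
apply/forallP => k; apply/implyP; apply: contraR => sk.
rewrite mnm_sumE big1 // => j _; rewrite mnm_sumE big1 // => l _.
rewrite mnm1E; case: eqP => // e; move: sk; rewrite -e slope_ixt.
have ltl : (l < m)%N by rewrite (leq_trans (ltn_ord l)) // -ltnS.
rewrite !inordK //; last by rewrite ltnW.
by rewrite -addn1 PoszD addrAC subrr add0r mulr1 eqxx.
Qed.

(** Restricted to this diagonal, the generic matrix or its transpose is subdiagonal, so a single
    monomial survives. *)
Lemma slope_part_cyc_poly b :
  exists c : bool, slope_part (sgb b) (cyc_poly b) = (-1) ^+ c * 'X_[cyc_lead b].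
Proof.
pose s (l : nat) : S := 'X_(ixt b (inord l.+1) (inord l)).
have e : map_mx (slope_part (sgb b)) (generic_mx K m b) = subdiag_mx m s.
  apply/matrixP => i j; rewrite !mxE /= slope_partX slope_ixt.
  have -> : (sgb b * (i%:Z - j%:Z) == sgb b) = (i == j.+1 :> nat).
    by rewrite /sgb; case: b {s}; apply/eqP/eqP; lia.
  by case: eqP => // e; rewrite /s -e !inord_val.
have [c ec] := cyc_det_subdiag m s; exists c.
rewrite /cyc_poly -map_cyc_det e ec; congr (_ * _).
have morphX := big_morph (fun u => 'X_[u] : S) (@mpolyXD _ _) (@mpolyX0 _ _).
by rewrite /cyc_lead morphX; apply: eq_bigr => j _; rewrite morphX.
Qed.

Lemma wlead_cyc_poly b :
  cyc_poly b != 0 /\ wlead (@weight m) (cyc_poly b) = cyc_lead b.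
Proof.
have [c ec] := slope_part_cyc_poly b.
have e u : on_slope (sgb b) u -> (cyc_poly b)@_u = (-1) ^+ c * (cyc_lead b == u)%:R.
  move=> os; have := mcoeff_slope_part (sgb b) (cyc_poly b) u; rewrite os ec => <-.
  by rewrite -mcoeffX; case: c {ec}; rewrite ?expr0 ?mul1r // expr1 !mulN1r mcoeffN.
have nz : (cyc_poly b)@_(cyc_lead b) != 0.
  by rewrite e ?on_slope_cyc_lead // eqxx mulr1 signr_eq0.
split; first by apply: contra_neq nz => ->; rewrite mcoeff0.
apply: (wlead_slope (d := cyc_deg) (s := sgb b)) => //.
- by have := cyc_degE; lia.
- exact: graded_cyc_poly.
- exact: on_slope_cyc_lead.
move=> u; rewrite mcoeff_msupp => + os; rewrite e //.
have [->|_] := eqVneq (cyc_lead b) u; first by [].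
by rewrite mulr0n mulr0 eqxx.
Qed.

Lemma on_slope_wlead_cyc_poly b : on_slope (sgb b) (wlead (@weight m) (cyc_poly b)).
Proof. by have [_ ->] := wlead_cyc_poly b; apply: on_slope_cyc_lead. Qed.

Definition nil_gens : seq S := [seq nil_gen K m k | k <- iota 0 n].
Definition nil_ideal : S -> Prop := ideal_gen nil_gens.

Lemma nil_lead_coprime (i j : 'I_n) d e u v : i != j ->
  u = nil_lead i d -> v = nil_lead j e -> mnm_coprime u v.
Proof.
move=> neq -> ->; apply/forallP => k; rewrite !mulmnE !mnm1E.
have [ei|_] := eqVneq (ix i i) k; last by rewrite mul0n eqxx.
have [ej|_] := eqVneq (ix j j) k; last by rewrite mul0n eqxx orbT.
have := congr1 (@ix_row m) (etrans ei (esym ej)); rewrite !ix_rowE /= => /val_inj eij.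
by rewrite eij eqxx in neq.
Qed.

(** The leading monomials live on the diagonals of slopes -1, 1 and 0, which are disjoint; those of
    slope 0 are powers of distinct diagonal variables. *)
Lemma nil_coprime_leads :
  coprime_leads (@weight m) [:: cyc_poly true, cyc_poly false & nil_gens].
Proof.
have [t1 _] := wlead_cyc_poly true; have [f1 _] := wlead_cyc_poly false.
have onE k : (k < n)%N -> exists2 u, wlead (@weight m) (nil_gen K m k) = u & on_slope 0 u.
  move=> ltk; have [_ e] := wlead_nil_gen K (Ordinal ltk).
  exists (wlead (@weight m) (nil_gen K m k)) => //.
  rewrite [nil_gen K m k](_ : _ = nil_gen K m (Ordinal ltk)) // e.
  exact: on_slope_nil_lead.
have copE b :
    all (fun h => mnm_coprime (wlead (@weight m) h) (wlead (@weight m) (cyc_poly b))) nil_gens.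
  apply/allP => h /mapP[k]; rewrite mem_iota add0n => /onE[u eu os] ->.
  by rewrite eu; apply: (on_slope_coprime os (on_slope_wlead_cyc_poly b)); case: b.
have tf :
    mnm_coprime (wlead (@weight m) (cyc_poly false)) (wlead (@weight m) (cyc_poly true)).
  exact: (on_slope_coprime (on_slope_wlead_cyc_poly _) (on_slope_wlead_cyc_poly _)).
apply: coprime_leads_cons t1 _ _.
  by apply/allP => h; rewrite inE => /orP[/eqP->|/(allP (copE true))].
apply: coprime_leads_cons f1 (copE false) _; rewrite /coprime_leads; apply/andP; split.
  apply/allP => h /mapP[k]; rewrite mem_iota add0n => ltk ->.
  by have [] := wlead_nil_gen K (Ordinal ltk).
rewrite pairwise_map; apply/(pairwiseP 0%N) => i j; rewrite !inE !size_iota => lti ltj ltij.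
have ei : nth 0%N (iota 0 n) i = i by rewrite nth_iota.
have ej : nth 0%N (iota 0 n) j = j by rewrite nth_iota.
rewrite ei ej; apply: (@nil_lead_coprime (Ordinal ltj) (Ordinal lti)).
- by rewrite -val_eqE /= gtn_eqF.
- exact: (proj2 (wlead_nil_gen K (Ordinal ltj))).
- exact: (proj2 (wlead_nil_gen K (Ordinal lti))).
Qed.

Lemma cyc_false_regular a : nil_ideal (a * cyc_poly false) -> nil_ideal a.
Proof.
apply: (coprime_lead_regular (@weight_gt0 m)).
exact: coprime_leads_behead nil_coprime_leads.
Qed.

Lemma cyc_true_regular a :
  ideal_add nil_ideal (cyc_poly false) (a * cyc_poly true) ->
  ideal_add nil_ideal (cyc_poly false) a.
Proof. exact: (coprime_lead_regular (@weight_gt0 m) nil_coprime_leads). Qed.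

(** The passage from the coefficients to the [nil_gen] is unitriangular, so it is inverted by
    descending induction on k. *)
Lemma cp_coef_nil_ideal k : (k < n)%N -> nil_ideal (cp_coef K m k).
Proof.
have [I0 ID IM] := ideal_gen_is_ideal nil_gens.
move=> ltkn; have [t] : exists t, t = (n - k)%N by eexists.
elim/ltn_ind: t k ltkn => t IH k ltkn et.
have -> : cp_coef K m k = nil_gen K m k +
    \sum_(j < n | (k < j)%N) - newton (diag_var K m) k j * cp_coef K m j.
  rewrite /nil_gen (bigID (fun j : 'I_n => (k < j)%N)) /= addrAC -big_split /=.
  rewrite [X in X + _]big1 ?add0r => [|j _]; last by rewrite mulNr mulrC subrr.
  rewrite (bigD1 (Ordinal ltkn)) ?ltnn //= newton_diag mulr1 big1 ?addr0 // => j /andP[].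
  rewrite -leqNgt leq_eqVlt => /orP[/eqP e|lt _]; last by rewrite newton_lt ?mulr0.
  by rewrite -val_eqE /= e eqxx.
apply: (ID); first by apply: ideal_gen_mem; rewrite map_f // mem_iota.
elim/big_rec: _ => [|j x ltkj Ix]; first exact: I0.
apply: (ID) => //; apply: IM; apply: (IH (n - j)%N) => //; rewrite et.
by have := ltn_ord j; lia.
Qed.

Lemma nil_ideal_morph (T : nzRingType) (f : {rmorphism S -> T}) h :
  (forall k, (k < n)%N -> f (cp_coef K m k) = 0) -> nil_ideal h -> f h = 0.
Proof.
move=> hc; apply: ideal_gen_morph => g /mapP[k _ ->].
by rewrite rmorph_sum big1 // => j _; rewrite rmorphM hc ?mul0r.
Qed.

End CyclicityPolynomials.

(** * Normality from two charts *)

Section TwoCharts.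
Local Open Scope ring_scope.
Variable B : comNzRingType.

(** States that B lies between a normal domain Q and Q[1/f], without forming these localizations. *)
Definition normal_chart (F : B) := (forall x, F * x = 0 -> x = 0) /\
  exists (Q : comNzRingType) (iota : {rmorphism Q -> B}) (f : Q),
    [/\ icd Q, injective iota, iota f = F &
        forall b, exists k a, F ^+ k * b = iota a].

Lemma chart_domain F : normal_chart F -> domain_ring B.
Proof.
case=> regF [Q [iota [f [[dQ _] inj fF den]]]].
apply: (@fractions_domain Q B iota (fun s => exists k, s = f ^+ k)) => //.
  move=> _ b [k ->]; rewrite rmorphXn fF; elim: k => [|k IH]; first by rewrite mul1r.
  by rewrite exprS -mulrA => /regF.
by move=> b; have [k [a e]] := den b; exists (f ^+ k); [exists k | exists a; rewrite rmorphXn fF].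
Qed.

Lemma chart_dvd F (p : {poly B}) (x y : B) : normal_chart F ->
  p \is monic -> y <> 0 -> homog_eval p x y = 0 -> exists k z, F ^+ k * x = z * y.
Proof.
case=> regF [Q [iota [f [[dQ iQ] inj fF den]]]] pm y0 pxy.
have [|||| _ [k ->] [z ez]] :=
    @fractions_int_dvd Q B iota (fun s => exists k, s = f ^+ k) _ _ _ inj _ p x y iQ pm y0 pxy.
- by exists 0%N.
- by move=> _ _ [k ->] [l ->]; exists (k + l)%N; rewrite exprD.
- move=> _ b [k ->]; rewrite rmorphXn fF; elim: k => [|k IH]; first by rewrite mul1r.
  by rewrite exprS -mulrA => /regF.
- by move=> b; have [k [a e]] := den b; exists (f ^+ k); [exists k | exists a; rewrite rmorphXn fF].
by exists k, z; rewrite -ez rmorphXn fF.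
Qed.

(** Powers of G are cancelled modulo F one factor at a time; then F is divided out and the exponent
    k decreases. *)
Lemma regular_powers (F G : B) : (forall x, F * x = 0 -> x = 0) ->
  (forall a b, a * G = b * F -> exists c, a = c * F) ->
  forall k l a b, a * G ^+ l = b * F ^+ k -> exists c, a = c * F ^+ k.
Proof.
move=> regF regFG.
have regl l a b : a * G ^+ l = b * F -> exists c, a = c * F.
  elim: l a b => [|l IH] a b; first by rewrite mulr1 => ->; exists b.
  by rewrite exprSr mulrA => /regFG[c /IH].
elim=> [|k IH] l a b e; first by exists a; rewrite mulr1.
have [c ec] : exists c, a = c * F by apply: (regl l a (b * F ^+ k)); rewrite -mulrA -exprSr.
have [c' ec'] : exists c', c = c' * F ^+ k.
  apply: (IH l c b); apply/eqP; rewrite -subr_eq0; apply/eqP/regF.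
  rewrite mulrBr; apply/eqP; rewrite subr_eq0; apply/eqP.
  by move: e; rewrite ec exprS => e; rewrite mulrA [F * c]mulrC e; ring.
by exists c'; rewrite ec ec' exprSr mulrA.
Qed.

(* The regularity of the pair [F, G] says that B is the intersection of its
   localizations at [F] and at [G]. *)
Lemma two_charts_icd (F G : B) : normal_chart F -> normal_chart G ->
  (forall a b, a * G = b * F -> exists c, a = c * F) -> icd B.
Proof.
move=> cF cG regFG; have dB := chart_domain cF; split=> // p x y pm y0 pxy.
have [k [a ea]] := chart_dvd cF pm y0 pxy; have [l [b eb]] := chart_dvd cG pm y0 pxy.
have [regF _] := cF.
have [c ec] : exists c, a = c * F ^+ k.
  apply: (@regular_powers F G regF regFG k l a b).
  have : (a * G ^+ l - b * F ^+ k) * y = 0.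
    transitivity (G ^+ l * (a * y) - F ^+ k * (b * y)); first by ring.
    by rewrite -ea -eb; ring.
  by case/dB => // /eqP; rewrite subr_eq0 => /eqP.
exists c; apply/eqP; rewrite -subr_eq0; apply/eqP.
have : F ^+ k * (x - c * y) = 0 by rewrite mulrBr ea ec; ring.
elim: k {a ea ec} => [|k IH]; first by rewrite mul1r.
by rewrite exprS -mulrA => /regF.
Qed.

End TwoCharts.

(** * Polynomials as functions over an algebraically closed field *)

Section PolynomialFunctions.
Local Open Scope ring_scope.
Variable K : closedFieldType.

Lemma poly_vanish (p : {poly K}) : (forall x, p.[x] = 0) -> p = 0.
Proof.
move=> h; apply: contrapT => /eqP p0.
(* For nonzero p this polynomial is nonconstant, but at a root of it the vanishing of p would give 1
   = 0. *)
have /closed_rootP[x] : size (p * 'X + 1) != 1%N.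
  by rewrite size_MXaddC (negPf p0) /= eqSS size_poly_eq0.
by rewrite rootE hornerD hornerM h mul0r add0r hornerC oner_eq0.
Qed.

Lemma mpoly_vanish N (p : {mpoly K[N]}) : (forall v : 'I_N -> K, p.@[v] = 0) -> p = 0.
Proof.
elim: N p => [|N IH] p h.
  have := h (fun=> 0); rewrite -[p in p.@[_]]mpolyKC mevalC => e.
  by rewrite -[p]mpolyKC e mpolyC0.
have e (v : 'I_N.+1 -> K) :
    p.@[v] = (map_poly (meval (fun i => v (widen_ord (leqnSn N) i))) (muni p)).[v ord_max].
  pose g : {rmorphism {mpoly K[N.+1]} -> K} := horner_eval (v ord_max)
    \o (map_poly (meval (fun i => v (widen_ord (leqnSn N) i))) \o @muni N K).
  apply: (mpoly_rmorph_ext (f := meval v) (g := g)) => [c|i].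
    by rewrite [LHS]mevalC /g /= muniC map_polyC /horner_eval hornerC /= mevalC.
  rewrite [LHS]mevalXU /g /=; case: (unliftP ord_max i) => [j ->|->]; last first.
    by rewrite muni_ord_max map_polyX /horner_eval hornerX.
  have -> : lift ord_max j = widen_ord (leqnSn N) j.
    by apply: val_inj; rewrite /= /bump leqNgt ltn_ord.
  by rewrite muni_widen map_polyC /horner_eval hornerC /= mevalXU.
have mp0 : muni p = 0.
  apply/polyP => k; rewrite coef0; apply: IH => v.
  have q0 : map_poly (meval v) (muni p) = 0.
    apply: poly_vanish => x.
    pose v' (i : 'I_N.+1) := if unlift ord_max i is Some j then v j else x.
    have := h v'; rewrite e /v' unlift_none; congr (_.[x] = 0); apply: eq_map_poly => q.
    apply: meval_eq => i; have -> : widen_ord (leqnSn N) i = lift ord_max i.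
      by apply: val_inj; rewrite /= /bump leqNgt ltn_ord.
    by rewrite liftK.
  by rewrite -coef_map q0 coef0.
by rewrite -(muniK p) mp0 rmorph0.
Qed.

End PolynomialFunctions.

(** * The coordinate ring of the nilpotent cone *)

Section NilpotentVariety.
Local Open Scope ring_scope.
Variables (K : closedFieldType) (m : nat).
Local Notation n := m.+1.
Local Notation S := {mpoly K[n * n]}.
Local Notation ix := (@mxvec_index n n).
Local Notation X := (generic_mx K m).
Local Notation f := (cyc_poly K m false).
Local Notation I := (@nil_ideal K m).

Definition mx_point (r c : nat) (A : 'M[K]_(r, c)) (k : 'I_(r * c)) : K := mxvec A ord0 k.

Lemma eval_generic (A : 'M[K]_n) : map_mx (meval (mx_point A)) (X false) = A.
Proof. by apply/matrixP => i j; rewrite !mxE mevalXU /mx_point mxvecE. Qed.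

Definition nil_vanish (a : S) :=
  forall A : 'M[K]_n, char_poly A = 'X^n -> a.@[mx_point A] = 0.

Lemma nil_vanish_cp_coef k : (k < n)%N -> nil_vanish (cp_coef K m k).
Proof.
move=> ltk A cA; rewrite -[LHS](coef_map_char_poly (meval (mx_point A))) eval_generic cA.
by rewrite coefXn ltn_eqF.
Qed.

Lemma nil_ideal_vanish a : I a -> nil_vanish a.
Proof.
move=> Ia A cA; apply: (nil_ideal_morph (f := meval (mx_point A))) Ia => k ltk.
exact: nil_vanish_cp_coef.
Qed.

(** Transposition preserves the nilpotent cone and exchanges the two cyclicity polynomials, so the
    second chart follows from the first. *)
Definition transp : S -> S :=
  comp_mpoly [tuple mxvec (X true) ord0 k | k < n * n].
HB.instance Definition _ := GRing.RMorphism.on transp.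

Lemma transpX i j : transp 'X_(ix i j) = 'X_(ix j i).
Proof. by rewrite /transp comp_mpolyXU -tnth_nth tnth_mktuple mxvecE mxE. Qed.

Lemma transp_cyc_poly : transp f = cyc_poly K m true.
Proof.
rewrite -map_cyc_det; congr cyc_det; apply/matrixP => i j.
by rewrite !mxE /= transpX.
Qed.

Lemma transpK : cancel transp transp.
Proof.
move=> a; apply: (mpoly_rmorph_ext (f := transp \o transp) (g := idfun)) => [c|k] /=.
  by rewrite /transp !comp_mpolyC.
by case/mxvec_indexP: k => i j; rewrite !transpX.
Qed.

Lemma eval_transp (A : 'M[K]_n) a : (transp a).@[mx_point A] = a.@[mx_point A^T].
Proof.
apply: (mpoly_rmorph_ext (f := meval (mx_point A) \o transp)
  (g := meval (mx_point A^T))) => [c|k] /=.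
  by rewrite /transp comp_mpolyC !mevalC.
by case/mxvec_indexP: k => i j; rewrite transpX !mevalXU /mx_point !mxvecE mxE.
Qed.

Lemma char_poly_tr (A : 'M[K]_n) : char_poly A^T = char_poly A.
Proof.
rewrite /char_poly -[RHS]det_tr; congr (\det _); apply/matrixP => i j.
by rewrite !mxE eq_sym.
Qed.

Lemma nil_vanish_transp a : nil_vanish a -> nil_vanish (transp a).
Proof. by move=> h A cA; rewrite eval_transp; apply: h; rewrite char_poly_tr. Qed.

(* Polynomials in the entries outside of the first row. *)
Local Notation Q := {mpoly K[m * n]}.

Definition lower_inj : Q -> S :=
  comp_mpoly [tuple
    mxvec (\matrix_(i < m, j < n) ('X_(ix (lift ord0 i) j) : S)) ord0 k | k < m * n].
HB.instance Definition _ := GRing.RMorphism.on lower_inj.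

Lemma lower_injX i j : lower_inj 'X_(mxvec_index i j) = 'X_(ix (lift ord0 i) j).
Proof. by rewrite /lower_inj comp_mpolyXU -tnth_nth tnth_mktuple mxvecE mxE. Qed.

Lemma lower_injC c : lower_inj c%:MP = c%:MP.
Proof. by rewrite /lower_inj comp_mpolyC. Qed.

Definition lower_mx : 'M[Q]_n :=
  \matrix_(i, j) if unlift ord0 i is Some i' then 'X_(mxvec_index i' j) else 0.

Lemma lower_mxE i j : i != ord0 -> map_mx lower_inj lower_mx i j = X false i j.
Proof.
case: (unliftP ord0 i) => [i' ->|->]; last by rewrite eqxx.
by rewrite !mxE liftK lower_injX.
Qed.

Lemma lower_cyc_det : lower_inj (cyc_det lower_mx) = f.
Proof. by rewrite -map_cyc_det; apply: cyc_det_eq => i j i0; apply: lower_mxE. Qed.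

Lemma eval_lower_inj (A : 'M[K]_n) q :
  (lower_inj q).@[mx_point A] = q.@[mx_point (row' ord0 A)].
Proof.
apply: (mpoly_rmorph_ext (f := meval (mx_point A) \o lower_inj)
  (g := meval (mx_point (row' ord0 A)))) => [c|k] /=.
  by rewrite lower_injC !mevalC.
by case/mxvec_indexP: k => i j; rewrite lower_injX !mevalXU /mx_point !mxvecE mxE.
Qed.

(** Cramer's rule: modulo I the characteristic coefficients drop out of [row0_cramer], and what
    remains only involves the lower rows. *)
Lemma first_row_denom j :
  exists q, I (f * 'X_(ix ord0 j) - lower_inj q).
Proof.
exists ((row_rhs lower_mx *m \adj (row_cof_mx lower_mx)) ord0 j).
have [I0 ID IM] := ideal_gen_is_ideal (nil_gens K m).
have := congr1 (fun u : 'rV[S]_n => u ord0 j) (row0_cramer (X false)).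
rewrite mulmxBl !mxE => ->; rewrite rmorph_sum /=.
have -> : \sum_k (row_rhs (X false)) ord0 k * \adj (row_cof_mx (X false)) k j =
    \sum_k lower_inj (row_rhs lower_mx ord0 k * \adj (row_cof_mx lower_mx) k j).
  apply: eq_bigr => k _; rewrite rmorphM -(row_rhs_eq lower_mxE) -(row_cof_mx_eq lower_mxE).
  by rewrite map_row_rhs map_row_cof_mx -map_mx_adj !mxE.
rewrite addrAC subrr add0r -sumrN; elim/big_rec: _ => [|k a _ Ia]; first exact: I0.
apply: ID => //; rewrite -mulrN mulrC; apply: IM; rewrite mxE.
exact: cp_coef_nil_ideal.
Qed.

Lemma chart_denom a : exists k q, I (f ^+ k * a - lower_inj q).
Proof.
have [I0 ID IM] := ideal_gen_is_ideal (nil_gens K m).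
(* D is a subring containing the constants and all the variables, those of the first row by Cramer's
   rule. *)
pose D a := exists k q, I (f ^+ k * a - lower_inj q).
have DC c : D c%:MP.
  by exists 0%N, c%:MP; rewrite mul1r lower_injC subrr.
have DD b c : D b -> D c -> D (b + c).
  move=> [k [q h]] [l [r h']].
  set g := cyc_det lower_mx; exists (k + l)%N, (g ^+ l * q + g ^+ k * r).
  have -> : f ^+ (k + l) * (b + c) - lower_inj (g ^+ l * q + g ^+ k * r) =
    f ^+ l * (f ^+ k * b - lower_inj q) + f ^+ k * (f ^+ l * c - lower_inj r).
    by rewrite rmorphD !rmorphM !rmorphXn /= lower_cyc_det exprD; ring.
  by apply: ID; apply: IM.
have DM b c : D b -> D c -> D (b * c).
  move=> [k [q h]] [l [r h']]; exists (k + l)%N, (q * r).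
  have -> : f ^+ (k + l) * (b * c) - lower_inj (q * r) =
     f ^+ k * b * (f ^+ l * c - lower_inj r) + lower_inj r * (f ^+ k * b - lower_inj q).
    by rewrite rmorphM exprD; ring.
  by apply: ID; apply: IM.
have DX k : D 'X_k.
  case/mxvec_indexP: k => i j; case: (unliftP ord0 i) => [i' ->|->].
    by exists 0%N, 'X_(mxvec_index i' j); rewrite mul1r lower_injX subrr.
  by have [q h] := first_row_denom j; exists 1%N, q.
elim/mpolyind: a => [|c u p _ _ IH]; first by rewrite -mpolyC0; apply: DC.
apply: (DD) => //; rewrite -mul_mpolyC; apply: (DM) => //; rewrite mpolyXE_id.
elim/big_rec: _ => [|k p' _ IH']; first by rewrite -mpolyC1; apply: DC.
apply: (DM) => //; elim: (u k) => [|d IHd]; first by rewrite expr0 -mpolyC1; apply: DC.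
by rewrite exprS; apply: DM.
Qed.

(* Where [cyc_det] does not vanish, the lower rows are arbitrary and determine the first
   row of a nilpotent matrix. *)
Lemma lower_vanish q : nil_vanish (lower_inj q) -> q = 0.
Proof.
move=> hq; have f0 : cyc_det lower_mx != 0.
  have [nz _] := wlead_cyc_poly K m false.
  by apply: contra_neq nz => e; rewrite -lower_cyc_det e rmorph0.
suff /eqP : q * cyc_det lower_mx = 0 by rewrite mulf_eq0 (negPf f0) orbF => /eqP.
apply: mpoly_vanish => v; rewrite mevalM.
pose A0 := map_mx (meval v) lower_mx.
have -> : (cyc_det lower_mx).@[v] = cyc_det A0 by rewrite -map_cyc_det.
have [->|d0] := eqVneq (cyc_det A0) 0; first by rewrite mulr0.
pose r := (cyc_det A0)^-1 *: (row_rhs A0 *m \adj (row_cof_mx A0)).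
pose A := \matrix_(i, j) if i == ord0 then r ord0 j else A0 i j.
have AE i j : i != ord0 -> A i j = A0 i j by move=> i0; rewrite mxE (negPf i0).
have rA : row ord0 A = r by apply/rowP => j; rewrite !mxE eqxx.
have cA : char_poly A = 'X^n.
  apply: char_poly_eqXn => k; have := row0_system A.
  rewrite rA (row_cof_mx_eq AE) (row_rhs_eq AE) /r -scalemxAl -mulmxA mul_adj_mx.
  rewrite mul_mx_scalar scalerA mulVf // scale1r => /rowP/(_ k); rewrite !mxE.
  by move/eqP; rewrite -subr_eq0 opprB addrC subrK => /eqP.
have := hq A cA; rewrite eval_lower_inj => e.
rewrite [q.@[v]](_ : _ = 0) ?mul0r // -{}e; apply: meval_eq => k.
case/mxvec_indexP: k => i j; rewrite /mx_point mxvecE mxE AE; last by rewrite eq_sym neq_lift.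
by rewrite !mxE liftK mevalXU.
Qed.

Lemma nil_ideal_powers k a : I (f ^+ k * a) -> I a.
Proof.
elim: k => [|k IH]; first by rewrite mul1r.
by rewrite exprS -mulrA mulrC => /cyc_false_regular/IH.
Qed.

(** Modulo I, a power of f moves a into the polynomials in the lower rows, where vanishing on the
    cone forces 0; this power is then cancelled, as f is regular modulo I. *)
Lemma nil_vanish_ideal a : nil_vanish a -> I a.
Proof.
move=> ha; have [k [q h]] := chart_denom a.
have q0 : q = 0.
  apply: lower_vanish => A cA; have := nil_ideal_vanish h cA.
  by rewrite mevalB mevalM ha // mulr0 sub0r => /eqP; rewrite oppr_eq0 => /eqP.
by apply: (@nil_ideal_powers k); move: h; rewrite q0 rmorph0 subr0.
Qed.

Section CoordinateRing.
Variables (B : comNzRingType).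

(** Presents B as the coordinate ring of the cone up to isomorphism. The freedom in [psi] serves
    both the transposed chart and the coordinates on the dual of pgl_n. *)
Definition nil_coord (psi : {rmorphism S -> B}) :=
  (forall b, exists a, psi a = b) /\ (forall a, psi a = 0 <-> nil_vanish a).

Lemma nil_normal_chart psi : nil_coord psi -> normal_chart (psi f).
Proof.
case=> surj ker; split.
  move=> b; have [a <-] := surj b; rewrite -rmorphM => /ker/nil_vanish_ideal h.
  by apply/ker/nil_ideal_vanish/(@nil_ideal_powers 1).
exists Q, (psi \o lower_inj), (cyc_det lower_mx); split.
- exact: icd_mpoly.
- apply: raddf_inj => q /= /ker; exact: lower_vanish.
- by rewrite /= lower_cyc_det.
- move=> b; have [a <-] := surj b; have [k [q h]] := chart_denom a.
  exists k, q; apply/eqP; rewrite -subr_eq0 -rmorphXn -rmorphM -rmorphB; apply/eqP.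
  exact/ker/nil_ideal_vanish.
Qed.

Lemma nil_coord_icd psi : nil_coord psi -> icd B.
Proof.
move=> cpsi; have [surj ker] := cpsi.
apply: (@two_charts_icd B (psi f) (psi (transp f))).
- exact: nil_normal_chart.
- apply: (@nil_normal_chart (psi \o transp)); split=> [b|a] /=.
    by have [a <-] := surj b; exists (transp a); rewrite transpK.
  split=> [/ker/nil_vanish_transp|/nil_vanish_transp h]; first by rewrite transpK.
  exact/ker.
move=> a b; have [a' <-] := surj a; have [b' <-] := surj b => e.
rewrite transp_cyc_poly in e.
have lift_eq a1 g1 b1 f1 : psi a1 * psi g1 = psi b1 * psi f1 -> I (a1 * g1 - b1 * f1).
  move=> e1; apply: nil_vanish_ideal; apply: (proj1 (ker _)).
  by rewrite rmorphB !rmorphM e1 subrr.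
have psiE h1 c1 f1 : psi h1 = 0 -> psi (h1 + c1 * f1) = psi c1 * psi f1.
  by move=> e1; rewrite rmorphD rmorphM e1 add0r.
(* The relation in B is lifted to S, where the regular sequence is available. *)
have : ideal_add I f (a' * cyc_poly K m true).
  exists (a' * cyc_poly K m true - b' * f), b'; split; first exact: lift_eq.
  by rewrite subrK.
move=> /cyc_true_regular[h [c [Ih ->]]]; exists (psi c).
by apply: psiE; apply: (proj2 (ker _)); apply: nil_ideal_vanish.
Qed.

End CoordinateRing.

End NilpotentVariety.

(** * Conjugation invariants on the nilpotent cone *)

Section ConjugationInvariants.
Local Open Scope ring_scope.
Variables (K : closedFieldType) (m : nat).
Local Notation n := m.+1.
Local Notation S := {mpoly K[n * n]}.
Local Notation ix := (@mxvec_index n n).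

Definition shift_mx : 'M[K]_n := \matrix_(i, j) (i.+1 == j :> nat)%:R.

(* Compare coefficients in (x - A) adj(x - A) = x^n, first column. *)
Lemma row_cof_shift (A : 'M[K]_n) : char_poly A = 'X^n ->
  A *m row_cof_mx A = row_cof_mx A *m shift_mx.
Proof.
move=> cA; apply/matrixP => i k.
have := congr1 (fun M : 'M[{poly K}]_n => (M i ord0)`_k) (mul_mx_adj (char_poly_mx A)).
rewrite -/(char_poly A) cA !mxE coefMn coefXn ltn_eqF // mul0rn coef_sum.
have e (j : 'I_n) : (char_poly_mx A i j * (\adj (char_poly_mx A)) j ord0)`_k =
    (('X *+ (i == j)) * row_cof A j)`_k - A i j * (row_cof A j)`_k.
  by rewrite [in LHS]/adjugate !mxE mulrBl coefB coefCM.
rewrite (eq_bigr _ (fun j _ => e j)) sumrB => /eqP; rewrite subr_eq0 => /eqP eq.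
transitivity (\sum_j A i j * (row_cof A j)`_k).
  by apply: eq_bigr => j _; rewrite mxE.
rewrite -eq (bigD1 i) //= eqxx big1 ?addr0 => [|j ji]; last first.
  by rewrite eq_sym (negPf ji) mul0r coef0.
rewrite mulr1n coefXM; case: k {e eq} => [[|k] ltk] /=.
  by rewrite big1 // => j _; rewrite [shift_mx _ _]mxE mulr0.
rewrite (bigD1 (Ordinal (ltnW ltk : (k < n)%N))) //= !mxE eqxx mulr1 big1 ?addr0 // => j jk.
by rewrite [shift_mx _ _]mxE /= eqSS -val_eqE /= in jk *; rewrite (negPf jk) mulr0.
Qed.

Lemma shift_mx_tr0 : \tr shift_mx = 0.
Proof. by rewrite /mxtrace big1 // => i _; rewrite mxE gtn_eqF. Qed.

Lemma char_poly_conj (A g : 'M[K]_n) : g \in unitmx ->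
  char_poly (g *m A *m invmx g) = char_poly A.
Proof.
move=> gU; rewrite /char_poly.
have -> : char_poly_mx (g *m A *m invmx g) =
    map_mx polyC g *m char_poly_mx A *m map_mx polyC (invmx g).
  rewrite /char_poly_mx mulmxBr mulmxBl -!map_mxM; congr (_ - _).
  by rewrite mul_mx_scalar -scalemxAl -map_mxM mulmxV // map_mx1 scalemx1.
by rewrite !det_mulmx mulrAC -det_mulmx -map_mxM mulmxV // map_mx1 det1 mul1r.
Qed.

(** Invariance is asked for on trace zero matrices, since only these represent points of the dual of
    pgl_n. *)
Definition conj_invariant (a : S) := forall A g : 'M[K]_n, \tr A = 0 ->
  g \in unitmx -> a.@[mx_point (g *m A *m invmx g)] = a.@[mx_point A].

(* The nilpotent Jordan block is conjugate to its nonzero multiples. *)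
Lemma shift_mx_invariant (a : S) : conj_invariant a ->
  a.@[mx_point shift_mx] = a.@[mx_point (0 : 'M[K]_n)].
Proof.
move=> inva.
pose q : {poly K} := mmap (@polyC K) (fun k => (mx_point shift_mx k)%:P * 'X) a.
have qE t : q.[t] = a.@[mx_point (t *: shift_mx)].
  apply: (mpoly_rmorph_ext
    (f := horner_eval t \o mmap (@polyC K) (fun k => (mx_point shift_mx k)%:P * 'X))
    (g := meval (mx_point (t *: shift_mx)))) => [c|k].
    by rewrite [RHS]mevalC /= mmapC /horner_eval hornerC.
  rewrite [RHS]mevalXU /= mmapX mmap1U /horner_eval hornerM hornerC hornerX.
  by case/mxvec_indexP: k => i j; rewrite /mx_point !mxvecE !mxE mulrC.
have q1 t : t != 0 -> q.[t] = q.[1].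
  move=> t0; rewrite !qE scale1r.
  pose d := diag_mx (\row_(i < n) t ^- i) : 'M[K]_n.
  have dU : d \in unitmx.
    rewrite unitmxE det_diag unitfE; apply/prodf_neq0 => i _.
    by rewrite mxE invr_eq0 expf_neq0.
  have e : d *m shift_mx = t *: (shift_mx *m d).
    apply/matrixP => i j; rewrite !mxE (bigD1 i) //= big1 ?addr0 => [|k ki]; last first.
      by rewrite !mxE eq_sym (negPf ki) mulr0n mul0r.
    rewrite (bigD1 j) //= [X in t * (_ + X)]big1 ?addr0 => [|k kj]; last first.
      by rewrite !mxE (negPf kj) mulr0n mulr0.
    rewrite !mxE !eqxx !mulr1n; case: eqP => [<-|_]; last by rewrite mulr0 mul0r mulr0.
    by rewrite mulr1 mul1r exprS invfM mulrA mulfV ?mul1r.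
  rewrite -(inva shift_mx d) ?shift_mx_tr0 //; congr (a.@[mx_point _]).
  by rewrite e -scalemxAl mulmxK.
(* The factor 'X takes care of t = 0, a value which [q1] does not cover. *)
have q0 : (q - q.[1]%:P) * 'X = 0.
  apply: poly_vanish => t; rewrite hornerM hornerX hornerD hornerN hornerC.
  by have [->|/q1->] := eqVneq t 0; rewrite ?mulr0 ?subrr ?mul0r.
have qc : q = q.[1]%:P.
  by move/eqP: q0; rewrite mulf_eq0 polyX_eq0 orbF subr_eq0 => /eqP.
transitivity q.[1]; first by rewrite qE scale1r.
by have := qE 0; rewrite scale0r => <-; rewrite [in RHS]qc hornerC.
Qed.

(* A nilpotent matrix where [cyc_det] does not vanish is conjugate to [shift_mx]; the
   others are dealt with by the regularity of [cyc_poly] modulo the equations. *)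
Lemma conj_invariant_nilpotent (a : S) (A : 'M[K]_n) : conj_invariant a ->
  char_poly A = 'X^n -> a.@[mx_point A] = a.@[mx_point (0 : 'M[K]_n)].
Proof.
move=> inva cA; set c := RHS.
suff /nil_ideal_vanish/(_ A cA) : nil_ideal (a - c%:MP).
  by rewrite mevalB mevalC => /eqP; rewrite subr_eq0 => /eqP.
apply: cyc_false_regular; apply: nil_vanish_ideal => {}A {}cA.
rewrite mevalM mevalB mevalC.
have -> : (cyc_poly K m false).@[mx_point A] = cyc_det A by rewrite -map_cyc_det eval_generic.
have [->|d0] := eqVneq (cyc_det A) 0; first by rewrite mulr0.
have gU : row_cof_mx A \in unitmx by rewrite unitmxE unitfE.
have AE : A = row_cof_mx A *m shift_mx *m invmx (row_cof_mx A).
  by rewrite -(row_cof_shift cA) mulmxK.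
by rewrite [in X in X - _]AE inva ?shift_mx_tr0 // shift_mx_invariant // subrr mul0r.
Qed.

End ConjugationInvariants.

(** * The dual nilpotent cone of PGL_n *)

Section SymmetricAlgebra.
Local Open Scope ring_scope.
Variables (K : fieldType) (V : vectType K).

(** The inclusion of V as the degree 1 part of S(V). *)
Definition sym_lin (v : V) : symalg V :=
  \sum_k coord (vbasis fullv) k v *: 'X_k.

Lemma sym_lin_is_linear : linear sym_lin.
Proof.
move=> c u v; rewrite /sym_lin scaler_sumr -big_split; apply: eq_bigr => k _ /=.
by rewrite linearP scalerDl scalerA.
Qed.

HB.instance Definition _ := GRing.isSemilinear.Build K V (symalg V) _ sym_lin
  (GRing.semilinear_linear sym_lin_is_linear).

Lemma symeval_lin v (X : dual V) : symeval (sym_lin v) X = X v.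
Proof.
rewrite /symeval /sym_lin raddf_sum /= {2}(coord_vbasis (memvf v)) linear_sum.
by apply: eq_bigr => k _; rewrite mevalZ mevalXU linearZ.
Qed.

Lemma sym_lin_basis (k : 'I_(\dim {:V})) : sym_lin (vbasis fullv)`_k = 'X_k.
Proof.
rewrite /sym_lin (bigD1 k) //= coord_free ?(basis_free (vbasisP _)) // eqxx scale1r.
rewrite big1 ?addr0 // => j jk.
by rewrite coord_free ?(basis_free (vbasisP _)) // eq_sym (negPf jk) scale0r.
Qed.

Lemma symeval0 (f : symalg V) : symeval f 0 = f@_0%MM.
Proof.
apply: (mpoly_rmorph_ext (f := meval (fun i => (0 : dual V) (vbasis fullv)`_i))
  (g := mcoeff 0%MM)) => [c|i]; first by rewrite [LHS]mevalC [RHS]mcoeffC eqxx mulr1.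
by rewrite [LHS]mevalXU lfunE /= mcoeffX mnm1_eq0.
Qed.

End SymmetricAlgebra.

Section DualNilcone.
Local Open Scope ring_scope.
Local Open Scope quotient_scope.
Variables (K : closedFieldType) (m : nat).
Local Notation n := m.+1.
Local Notation S := {mpoly K[n * n]}.
Local Notation ix := (@mxvec_index n n).
Local Notation V := (pgl K n).

Lemma pi_pgl_linear : linear (\pi_V : 'M[K]_n -> V).
Proof. exact: pi_quotv_is_linear. Qed.

Definition pi_pgl : 'M[K]_n -> V := \pi_V.
HB.instance Definition _ := GRing.isSemilinear.Build K 'M[K]_n V _ pi_pgl
  (GRing.semilinear_linear pi_pgl_linear).

Lemma pi_pgl_repr (x : V) : pi_pgl (repr x) = x.
Proof. exact: reprK. Qed.

Lemma pi_pgl_eq (A B : 'M[K]_n) : pi_pgl A = pi_pgl B -> exists c, A - B = c%:M.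
Proof.
by move=> /quotv_eqP/vlineP[c ->]; exists c; rewrite scalemx1.
Qed.

(* The trace form identifies the dual of gl_n / K.1 with the trace zero matrices,
   and the coadjoint action with conjugation. *)
Definition dual_mx (X : dual V) : 'M[K]_n := \matrix_(i, j) X (pi_pgl (delta_mx j i)).

Lemma dual_mxE (X : dual V) (A : 'M[K]_n) : X (pi_pgl A) = \tr (A *m dual_mx X).
Proof.
rewrite {1}(matrix_sum_delta A) !linear_sum /mxtrace; apply: eq_bigr => i _.
rewrite !linear_sum mxE; apply: eq_bigr => j _.
by rewrite !linearZ mxE.
Qed.

Lemma tr_delta_mul (i j : 'I_n) (A : 'M[K]_n) : \tr (delta_mx j i *m A) = A i j.
Proof.
rewrite /mxtrace (bigD1 j) //= big1 ?addr0 => [|k kj].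
  rewrite mxE (bigD1 i) //= big1 ?addr0 => [|l li]; first by rewrite mxE !eqxx mul1r.
  by rewrite mxE (negPf li) andbF mul0r.
by rewrite mxE big1 // => l _; rewrite mxE (negPf kj) mul0r.
Qed.

Lemma dual_mx_surj (A : 'M[K]_n) : \tr A = 0 -> exists X, dual_mx X = A.
Proof.
move=> trA; pose F (x : V) : K^o := \tr (repr x *m A).
(* Two representatives differ by a scalar matrix, which pairs to 0 with A because A has trace
   zero. *)
have FE M : F (pi_pgl M) = \tr (M *m A).
  have [c] := pi_pgl_eq (pi_pgl_repr (pi_pgl M)).
  move/eqP; rewrite subr_eq => /eqP e.
  by rewrite /F e mulmxDl mul_scalar_mx linearD linearZ /= trA mulr0 add0r.
have lin : linear F.
  move=> a x y; rewrite -(pi_pgl_repr x) -(pi_pgl_repr y) -linearP !FE.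
  by rewrite mulmxDl -scalemxAl linearP.
pose FL := GRing.isSemilinear.Build K V K^o _ _ (GRing.semilinear_linear lin).
pose G : {linear V -> K^o} := HB.pack F FL.
by exists (linfun G); apply/matrixP => i j; rewrite mxE lfunE /= FE tr_delta_mul.
Qed.

Lemma Ad_pi_pgl (g : GL K n) (A : 'M[K]_n) :
  Ad (\pi_(PGL K n) g) (pi_pgl A) = pi_pgl (GL_Ad g A).
Proof. exact: AdE. Qed.

Lemma dual_mx_coAd (g : GL K n) (X : dual V) :
  dual_mx (coAd (\pi_(PGL K n) g) X) = sval g *m dual_mx X *m invmx (sval g).
Proof.
apply/matrixP => i j; rewrite mxE coAdE.
have -> : ((\pi_(PGL K n) g)^-1)%g = \pi_(PGL K n) (GL_inv g).
  by rewrite [RHS]pi_PGL_inv.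
rewrite Ad_pi_pgl dual_mxE /GL_Ad /= invmxK.
by rewrite -!mulmxA mxtrace_mulC -!mulmxA tr_delta_mul !mulmxA.
Qed.

(** The pullback along [dual_mx], hence the exchanged indices: it restricts polynomials on all
    matrices to those of trace zero. *)
Definition sym_coord : S -> symalg V :=
  comp_mpoly [tuple
    mxvec (\matrix_(i < n, j < n) sym_lin (pi_pgl (delta_mx j i))) ord0 k | k < n * n].
HB.instance Definition _ := GRing.RMorphism.on sym_coord.

Lemma sym_coordX i j : sym_coord 'X_(ix i j) = sym_lin (pi_pgl (delta_mx j i)).
Proof. by rewrite /sym_coord comp_mpolyXU -tnth_nth tnth_mktuple mxvecE mxE. Qed.

Lemma sym_coordC c : sym_coord c%:MP = c%:MP.
Proof. by rewrite /sym_coord comp_mpolyC. Qed.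

Lemma symeval_coord a (X : dual V) : symeval (sym_coord a) X = a.@[mx_point (dual_mx X)].
Proof.
apply: (mpoly_rmorph_ext (f := meval (fun i => X (vbasis fullv)`_i) \o sym_coord)
  (g := meval (mx_point (dual_mx X)))) => [c|k] /=.
  by rewrite sym_coordC !mevalC.
case/mxvec_indexP: k => i j; rewrite sym_coordX mevalXU -[LHS]/(symeval _ X) symeval_lin.
by rewrite /mx_point mxvecE mxE.
Qed.

Lemma sym_coord_surj (f : symalg V) : exists a, sym_coord a = f.
Proof.
have lin (A : 'M[K]_n) : exists a, sym_coord a = sym_lin (pi_pgl A).
  exists (\sum_i \sum_j A i j *: 'X_(ix j i)).
  rewrite {2}(matrix_sum_delta A) rmorph_sum !linear_sum; apply: eq_bigr => i _.
  rewrite rmorph_sum !linear_sum; apply: eq_bigr => j _.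
  by rewrite !linearZ /= -sym_coordX -!mul_mpolyC rmorphM /= sym_coordC.
elim/mpolyind: f => [|c u p _ _ [a <-]]; first by exists 0; rewrite rmorph0.
suff [b e] : exists b, sym_coord b = 'X_[u].
  by exists (c%:MP * b + a); rewrite rmorphD rmorphM /= sym_coordC e mul_mpolyC.
rewrite mpolyXE_id; elim/big_rec: _ => [|k q _ [b <-]]; first by exists 1; rewrite rmorph1.
have [a' e] : exists a', sym_coord a' = 'X_k.
  have [a' e] := lin (repr (vbasis {:V})`_k); exists a'.
  by rewrite e pi_pgl_repr sym_lin_basis.
by exists (a' ^+ u k * b); rewrite rmorphM rmorphXn /= e.
Qed.

Lemma coAd_invariant_conj a : coAd_invariant (sym_coord a) -> conj_invariant a.
Proof.
move=> h A g trA gU; have [X eX] := dual_mx_surj trA.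
have := h (\pi_(PGL K n) (mkGL gU)) X.
by rewrite !symeval_coord dual_mx_coAd eX.
Qed.

(** The lower characteristic coefficients are invariants of positive degree. Conversely, an
    invariant takes the same value at a nilpotent matrix as at 0, namely its constant term. *)
Lemma nilcone_pointsP (X : dual V) :
  nilcone_points X <-> char_poly (dual_mx X) = 'X^n.
Proof.
split=> [h|cX f [f0 finv]]; last first.
  have [a ea] := sym_coord_surj f; rewrite -ea in f0 finv *.
  rewrite symeval_coord (conj_invariant_nilpotent (coAd_invariant_conj finv) cX).
  rewrite -[RHS]f0 -symeval0 symeval_coord; congr (a.@[mx_point _]).
  by apply/matrixP => i j; rewrite !mxE lfunE.
apply: char_poly_eqXn => k.
have cE (Y : dual V) : symeval (sym_coord (cp_coef K m k)) Y = (char_poly (dual_mx Y))`_k.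
  rewrite symeval_coord.
  by rewrite -[LHS](coef_map_char_poly (meval (mx_point (dual_mx Y)))) eval_generic.
rewrite -cE; apply: h; split.
  rewrite /positive_degree -symeval0 cE (_ : dual_mx 0 = 0); last first.
    by apply/matrixP => i j; rewrite !mxE lfunE.
  by rewrite /char_poly /char_poly_mx map_mx0 subr0 det_scalar coefXn ltn_eqF.
move=> g Y; rewrite !cE; elim/quotW: g => g.
by rewrite dual_mx_coAd char_poly_conj // (svalP g).
Qed.

Lemma dual_nilcone_icd : icd (coord_ring (dual_nilcone K n)).
Proof.
pose Z := dual_nilcone K n.
pose psi : {rmorphism S -> coord_ring Z} := \pi_(coord_ring Z) \o sym_coord.
apply: (@nil_coord_icd K m (coord_ring Z) psi); split.
  elim/quotW => f; have [a <-] := sym_coord_surj f; by exists a.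
move=> a; have -> : psi a = 0 <-> forall X, Z X -> symeval (sym_coord a) X = 0.
  rewrite -(rmorph0 (\pi_(coord_ring Z))) /psi /=.
  split=> [/eqP|h].
    by rewrite -Quotient.idealrBE subr0 => /asboolP.
  by apply/eqP; rewrite -Quotient.idealrBE subr0; apply/asboolP.
split=> h.
  (* The trace of a nilpotent matrix is zero, so the matrix comes from a point of the dual. *)
  move=> A cA; have trA : \tr A = 0.
    have := char_poly_trace A (ltn0Sn m); rewrite cA coefXn /= ltn_eqF //.
    by move/eqP; rewrite eq_sym oppr_eq0 => /eqP.
  have [X eX] := dual_mx_surj trA; rewrite -eX -symeval_coord; apply: h.
  by apply/nilcone_pointsP; rewrite eX.
by move=> X /nilcone_pointsP cX; rewrite symeval_coord; apply: h.
Qed.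

End DualNilcone.

Theorem theorem1 (K : closedFieldType) (p n : nat) (hp : p \in [pchar K]%R)
  (hn : 0 < n) (hpn : p %| n) : normal_variety (dual_nilcone K n).
Proof.
by case: n hn {hpn} => // m _; apply/icd_normal_variety/dual_nilcone_icd.
Qed.
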